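(* Consider a nearest-neighbor mixture process (NNMP) $\{Z(\boldsymbol v):\boldsymbol v\in\mathcal D\}$ for which the component density $f_{\boldsymbol v,l}$ is specified by the conditional density of $U_{\boldsymbol v,l}$ given $V_{\boldsymbol v,l}$, where the random vector $(U_{\boldsymbol v,l},V_{\boldsymbol v,l})$ follows a bivariate distribution with marginal distribution functions $F_{U_{\boldsymbol v,l}}$ and $F_{V_{\boldsymbol v,l}}$, for $l=1,\dots,L$. Suppose that the spatial dependence of the random vector $(U_{\boldsymbol v,l},V_{\boldsymbol v,l})$ is built from the base vector $(U_l,V_l)$, which has a bivariate distribution such that $U_l$ is stochastically increasing in $V_l$, for $l=1,\dots,L$. Then, for every $\boldsymbol v$, the upper and lower tail dependence coefficients $\lambda_{\mathcal H}(\boldsymbol v)$ and $\lambda_{\mathcal L}(\boldsymbol v)$ of $Z(\boldsymbol v)$ given its nearest neighbors satisfy $$\lambda_{\mathcal H}(\boldsymbol v)\ \ge\ \sum_{l=1}^L w_l(\boldsymbol v)\lim_{q\to1^-}P\big(Z(\boldsymbol v)>F_{U_{\boldsymbol v,l}}^{-1}(q)\,\big|\,Z(\boldsymbol v_{(l)})=F_{V_{\boldsymbol v,l}}^{-1}(q)\big),$$ $$\lambda_{\mathcal L}(\boldsymbol v)\ \ge\ \sum_{l=1}^L w_l(\boldsymbol v)\lim_{q\to0^+}P\big(Z(\boldsymbol v)\le F_{U_{\boldsymbol v,l}}^{-1}(q)\,\big|\,Z(\boldsymbol v_{(l)})=F_{V_{\boldsymbol v,l}}^{-1}(q)\big),$$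 where the conditional probabilities on the right-hand sides are those corresponding to the bivariate random vector $(U_{\boldsymbol v,l},V_{\boldsymbol v,l})$ (with $Z(\boldsymbol v)$ in the role of $U_{\boldsymbol v,l}$ and $Z(\boldsymbol v_{(l)})$ in the role of $V_{\boldsymbol v,l}$).
   Context: Nearest-neighbor mixture process (NNMP). Let $\mathcal D\subset\mathbb R^p$, $p\ge 1$, and let $\mathcal S=\{\boldsymbol s_1,\dots,\boldsymbol s_n\}\subset\mathcal D$ be a finite ordered collection of locations (the reference set); $L$ is a positive integer, much smaller than $n$. For $\boldsymbol v=\boldsymbol s_i\in\mathcal S$, $i\ge2$, the neighbor set $\mathrm{Ne}(\boldsymbol s_i)\subset\{\boldsymbol s_1,\dots,\boldsymbol s_{i-1}\}$ consists of the $i_L:=\min(i-1,L)$ locations closest to $\boldsymbol s_i$; for $\boldsymbol v\in\mathcal D\setminus\mathcal S$, $\mathrm{Ne}(\boldsymbol v)\subset\mathcal S$ consists of the $L$ locations of $\mathcal S$ closest to $\boldsymbol v$. The elements of $\mathrm{Ne}(\boldsymbol v)$ in ascending order of distance to $\boldsymbol v$ are $\boldsymbol v_{(1)},\dots,\boldsymbol v_{(L)}$. The process is characterized by the conditional density of $Z(\boldsymbol v)$ given $\boldsymbol Z_{\mathrm{Ne}(\boldsymbol v)}=(Z(\boldsymbol v_{(1)}),\dots,Z(\boldsymbol v_{(L)}))$, $$p(z(\boldsymbol v)\mid\boldsymbol z_{\mathrm{Ne}(\boldsymbol v)})=\sum_{l=1}^{L}w_l(\boldsymbol v)\,f_{\boldsymbol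 v,l}(z(\boldsymbol v)\mid z(\boldsymbol v_{(l)})),\quad w_l(\boldsymbol v)\ge0,\ \sum_{l} w_l(\boldsymbol v)=1$$ (for $\boldsymbol v=\boldsymbol s_i$ with $i\le L$ the index $L$ is replaced by $i_L$). The joint density over $\mathcal S$ is $p(z(\boldsymbol s_1))\prod_{i=2}^n p(z(\boldsymbol s_i)\mid\boldsymbol z_{\mathrm{Ne}(\boldsymbol s_i)})$, and, given the values over $\mathcal S$, the values at finitely many non-reference locations $\boldsymbol u_1,\dots,\boldsymbol u_r$ have joint conditional density $\prod_{i=1}^r p(z(\boldsymbol u_i)\mid\boldsymbol z_{\mathrm{Ne}(\boldsymbol u_i)})$. Base random vectors. For each $l$, $(U_l,V_l)$ is a random vector with a bivariate distribution; ''$(U_{\boldsymbol v,l},V_{\boldsymbol v,l})$ is built from $(U_l,V_l)$'' means that its distribution is obtained by extending some of the parameters of the distribution of $(U_l,V_l)$ to be spatially varying, i.e. indexed by $\boldsymbol v$. The stochastically increasing property of the base vector is understood to carry over to $(U_{\boldsymbol v,l},V_{\boldsymbol v,l})$ for every $\boldsymbol v$. Stochastically increasing: $U$ is stochastically increasing in $V$ if $P(U>u\mid V=v)$ increases (is nondecreasing) as $v$ increases. Tail dependence coefficients of $Z(\boldsymbol v)$ given its nearest neighbors: with $F_{Z(\boldsymbol v)}$ the marginal distribution function of $Z(\boldsymbol v)$, $$\lambda_{\mathcal H}(\boldsymbol v)=\lim_{q\to1^-}P\big(Z(\boldsymbol v)>F_{Z(\boldsymbol v)}^{-1}(q)\mid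 Z(\boldsymbol v_{(1)})>F_{Z(\boldsymbol v_{(1)})}^{-1}(q),\dots,Z(\boldsymbol v_{(L)})>F_{Z(\boldsymbol v_{(L)})}^{-1}(q)\big),$$ $$\lambda_{\mathcal L}(\boldsymbol v)=\lim_{q\to0^+}P\big(Z(\boldsymbol v)\le F_{Z(\boldsymbol v)}^{-1}(q)\mid Z(\boldsymbol v_{(1)})\le F_{Z(\boldsymbol v_{(1)})}^{-1}(q),\dots,Z(\boldsymbol v_{(L)})\le F_{Z(\boldsymbol v_{(L)})}^{-1}(q)\big).$$
   Formalization: At the v considered, it is assumed that Z(v) and each neighbor Z(v_(l)) have the marginal distribution functions of U_{v,l} and V_{v,l}; without this the claim is false (e.g. Z(s_1) uniform on (0,1/2) with V uniform on (0,1)). The limits involved are assumed to exist. *)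

(* Defs.v *)
From HB Require Import structures.
From mathcomp Require Import all_boot all_order all_algebra.
From mathcomp Require Import all_classical all_reals all_analysis.

Set Implicit Arguments.
Unset Strict Implicit.
Unset Printing Implicit Defensive.

Import Order.TTheory GRing.Theory Num.Theory.
Import numFieldNormedType.Exports.

Local Open Scope classical_set_scope.
Local Open Scope ring_scope.

(* MathComp / MathComp-Analysis development, over an abstract [R : realType]. *)

Section bivariate.
Context {R : realType}.
Local Notation leb := (@lebesgue_measure R).

(* [h u v] is the joint Lebesgue density of a random vector (U, V). *)
Implicit Types (h : R -> R -> R).

Definition bivariate_density h : Prop :=
  [/\ measurable_fun [set: R * R] (fun uv => h uv.1 uv.2),
      forall u v, 0 <= h u v &
      (\int[leb]_v \int[leb]_u (h u v)%:E = 1)%E].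

Definition density_V h (v : R) : R := \int[leb]_u h u v.

Definition cdf_U h (x : R) : R :=
  fine (\int[leb]_(u in `]-oo, x]) \int[leb]_v (h u v)%:E)%E.

Definition cdf_V h (x : R) : R :=
  fine (\int[leb]_(v in `]-oo, x]) \int[leb]_u (h u v)%:E)%E.

(* Meaningful where [0 < density_V h v], and 0 elsewhere.  If the integral
   defining [density_V h v] is infinite, which happens only on a null set of
   [v], then [density_V h v] is 0 as well. *)
Definition cond_density h (u v : R) : R := h u v / density_V h v.

(* P(U > u | V = v) and P(U <= u | V = v) *)
Definition cond_gt h (u v : R) : R := \int[leb]_(x in `]u, +oo[) cond_density h x v.
Definition cond_le h (u v : R) : R := \int[leb]_(x in `]-oo, u]) cond_density h x v.

(* The monotonicity is required at the values [v] of V where conditioning on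
   V = v makes sense. *)
Definition stoch_increasing h : Prop :=
  forall u v1 v2, 0 < density_V h v1 -> 0 < density_V h v2 ->
    v1 <= v2 -> cond_gt h u v1 <= cond_gt h u v2.

(* Generalized inverse of a distribution function. *)
Definition quantile (F : R -> R) (q : R) : R := inf [set x | q <= F x].

End bivariate.

Section joint_density.
Context {R : realType}.
Local Notation leb := (@lebesgue_measure R).

(* Integral over R^m, as an iterated Lebesgue integral. *)
Fixpoint integral_tuple (m : nat) : (m.-tuple R -> \bar R) -> \bar R :=
  match m with
  | 0 => fun f => f [tuple]
  | k.+1 => fun f => (\int[leb]_x integral_tuple (fun t => f [tuple of x :: t]))%E
  end.

Context d (T : measurableType d) (P : probability T R).

(* Stated on measurable rectangles, which determine the law of [Y]. *)
Definition has_joint_density (m : nat) (Y : 'I_m -> {RV P >-> R})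
    (g : m.-tuple R -> R) : Prop :=
  forall A : 'I_m -> set R, (forall i, measurable (A i)) ->
    P [set t | forall i, A i (Y i t)] =
    integral_tuple (fun z => ((\prod_(i < m) \1_(A i) (tnth z i)) * g z)%:E).

Definition dist_fun (X : {RV P >-> R}) (x : R) : R := fine (cdf X x).

Definition cond_prob (A B : set T) : R := fine (P (A `&` B)) / fine (P B).

End joint_density.

Section nnmp.
Context {R : realType} {p n L : nat}.

(* Reference set; indices are 0-based, so [s 0] is the first location. *)
Variable s : 'I_n -> 'rV[R]_p.

Definition dist2 (x y : 'rV[R]_p) : R :=
  Num.sqrt (\sum_(k < p) (x ord0 k - y ord0 k) ^+ 2).

(* Indices of the locations among which the neighbors of [v] are selected: the
   predecessors of [v] if [v] is a reference location, all of them otherwise. *)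
Definition candidates (v : 'rV[R]_p) : {set 'I_n} :=
  finset (fun j : 'I_n => [forall i : 'I_n, (s i == v) ==> (j < i)%N]).

(* Equals min(i, L) at [s i] (0-based i), and L outside the reference set. *)
Definition num_neighbors (v : 'rV[R]_p) : nat := minn #|candidates v| L.

(* [nb v l] is the index of the (l+1)-st nearest neighbor of [v]; it is
   significant only for [l < num_neighbors v].  Ties between distances may be
   broken in any way. *)
Variable nb : 'rV[R]_p -> 'I_L -> 'I_n.

Definition is_neighbor_map (D : set 'rV[R]_p) : Prop :=
  forall v, D v ->
  [/\ forall l : 'I_L, (l < num_neighbors v)%N -> nb v l \in candidates v,
      forall l k : 'I_L, (l < k < num_neighbors v)%N -> nb v l <> nb v k,
      forall l k : 'I_L, (l < k < num_neighbors v)%N ->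
        dist2 v (s (nb v l)) <= dist2 v (s (nb v k)) &
      forall j, j \in candidates v ->
        (forall l : 'I_L, (l < num_neighbors v)%N -> nb v l <> j) ->
        forall l : 'I_L, (l < num_neighbors v)%N ->
          dist2 v (s (nb v l)) <= dist2 v (s j)].

Variable w : 'rV[R]_p -> 'I_L -> R.

(* The first reference location has no neighbor, hence no weights. *)
Definition is_weights (D : set 'rV[R]_p) : Prop :=
  forall v, D v -> (0 < num_neighbors v)%N ->
    (forall l : 'I_L, (l < num_neighbors v)%N -> 0 <= w v l) /\
    \sum_(l < L | (l < num_neighbors v)%N) w v l = 1.

(* [h v l] is the density of (U_{v,l}, V_{v,l}). *)
Variable h : 'rV[R]_p -> 'I_L -> R -> R -> R.

(* p(x | z_Ne(v)), where [zS i] is the value of the process at [s i]. *)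
Definition nnmp_cond_density (v : 'rV[R]_p) (x : R) (zS : 'I_n -> R) : R :=
  \sum_(l < L | (l < num_neighbors v)%N) w v l * cond_density (h v l) x (zS (nb v l)).

(* Joint density over the reference set and non-reference locations [u j];
   [f1] is the density at the first reference location. *)
Definition nnmp_joint_density (f1 : R -> R) (r : nat) (u : 'I_r -> 'rV[R]_p)
    (z : (n + r).-tuple R) : R :=
  let zS i := tnth z (lshift r i) in
  (\prod_(i < n) (if i == 0%N :> nat then f1 (zS i)
                  else nnmp_cond_density (s i) (zS i) zS)) *
  \prod_(j < r) nnmp_cond_density (u j) (tnth z (rshift n j)) zS.

Context d (T : measurableType d) (P : probability T R).
Variable Z : 'rV[R]_p -> {RV P >-> R}.

(* Only the values [Z v] at [v] in D matter.  The case r = 0 is the joint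
   density over the reference set alone. *)
Definition is_nnmp (D : set 'rV[R]_p) (f1 : R -> R) : Prop :=
  [/\ measurable_fun setT f1,
      forall x, 0 <= f1 x,
      (\int[@lebesgue_measure R]_x (f1 x)%:E = 1)%E &
      forall (r : nat) (u : 'I_r -> 'rV[R]_p), injective u ->
        (forall j, D (u j)) -> (forall i j, s i <> u j) ->
        has_joint_density
          (fun k => match fintype.split k with inl i => Z (s i) | inr j => Z (u j) end)
          (nnmp_joint_density f1 u)].

(* Z(v) and Z(v_(l)) have the marginal distributions of U_{v,l} and V_{v,l}.
   This is what lets the quantiles of U_{v,l} and V_{v,l} stand for those of
   Z(v) and Z(v_(l)); it is not a consequence of the form of the component
   densities (Z(s_1) may have any density). *)
Definition margins_agree (v : 'rV[R]_p) : Prop :=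
  forall l : 'I_L, (l < num_neighbors v)%N ->
    dist_fun (Z v) = cdf_U (h v l) /\ dist_fun (Z (s (nb v l))) = cdf_V (h v l).

Definition upper_tail_prob (v : 'rV[R]_p) (q : R) : R :=
  cond_prob P
    [set t | quantile (dist_fun (Z v)) q < Z v t]
    [set t | forall l : 'I_L, (l < num_neighbors v)%N ->
       quantile (dist_fun (Z (s (nb v l)))) q < Z (s (nb v l)) t].

Definition lower_tail_prob (v : 'rV[R]_p) (q : R) : R :=
  cond_prob P
    [set t | Z v t <= quantile (dist_fun (Z v)) q]
    [set t | forall l : 'I_L, (l < num_neighbors v)%N ->
       Z (s (nb v l)) t <= quantile (dist_fun (Z (s (nb v l)))) q].

Definition lambda_H (v : 'rV[R]_p) : R := lim (upper_tail_prob v q @[q --> 1^'-]).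
Definition lambda_L (v : 'rV[R]_p) : R := lim (lower_tail_prob v q @[q --> 0^'+]).

End nnmp.

Section component_tail.
Context {R : realType}.

(* P(U > F_U^-1(q) | V = F_V^-1(q)) and P(U <= F_U^-1(q) | V = F_V^-1(q)) *)
Definition component_gt (h : R -> R -> R) (q : R) : R :=
  cond_gt h (quantile (cdf_U h) q) (quantile (cdf_V h) q).
Definition component_le (h : R -> R -> R) (q : R) : R :=
  cond_le h (quantile (cdf_U h) q) (quantile (cdf_V h) q).

End component_tail.

(* Main.v *)
(** Write [Z_i] for the successive locations (the reference set, then possibly
    [v]).  The conditional law of [Z_m] given its predecessors is a mixture of
    one-parent kernels [K_l(z_l, .)], so for an upper tail [A] and tail events
    [B = {Z_l > b_l for all l}],
<<
      P(Z_m in A, B) = E[1_B sum_l w_l K_l(Z_l, A)] >= sum_l w_l K_l(b_l, A) P(B),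
>>
    because [K_l(z, A)] is nondecreasing in [z].  Dividing by [P(B)] and letting
    [q] tend to 1 gives the bound; lower tails are the same argument for the
    reverse order, as [K_l(z, A) = 1 - K_l(z, ~A)].

    Two points need care.  First, [P(B)] must be positive.  By induction on [m],
    [P(Z_i in B_i for all i < m) > 0] as soon as each [B_i] is closed upwards and
    [P(Z_i in B_i) > 0]: since [P(Z_m in B_m) > 0], some component [l] of positive
    weight has [P(Z_l in C) > 0], where [C], the up-closure of
    [{z | K_l(z, B_m) > 0}], is comparable with [B_l] for inclusion; hence
    [B_l] can be replaced by [B_l] intersected with [C], and on the resulting
    event the conditional probability of [Z_m in B_m] is positive.  Second, the
    kernels only make sense where the density of the conditioning variable is
    positive.  Elsewhere they vanish, so the successive marginal masses decrease
    from 1 to the total mass of the joint density, which is also 1: almost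
    surely, every component of positive weight has a valid parent value. *)
Require Import Defs.
From HB Require Import structures.
From mathcomp Require Import all_boot all_order all_algebra.
From mathcomp Require Import all_classical all_reals all_analysis.
From mathcomp Require Import measurable_realfun.
Import Order.TTheory GRing.Theory Num.Theory.
Import numFieldNormedType.Exports.
Local Open Scope classical_set_scope.
Local Open Scope ring_scope.

(** * Conditional laws and monotone sets *)

Section closed_sets.
Context {R : realType}.
Implicit Types (A B : set R).

(** Carrying the order as a parameter treats both tails at once: [<=%R] gives the up-closed sets and
    [>=%R] the down-closed ones. *)
Definition rel_closed (r : rel R) A := forall x y, A x -> r x y -> A y.

Lemma rel_closed_le_measurable A : rel_closed <=%R A -> measurable A.
Proof.
move=> cA; apply: is_interval_measurable => x y Ax _ z /andP[xz _].
exact: cA xz.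
Qed.

Lemma rel_closed_ge_measurable A : rel_closed >=%R A -> measurable A.
Proof.
move=> cA; apply: is_interval_measurable => x y _ Ay z /andP[_ zy].
exact: cA zy.
Qed.

Lemma rel_closed_geC A : rel_closed >=%R A -> rel_closed <=%R (~` A).
Proof. by move=> cA x y nAx xy Ay; apply: nAx; exact: cA xy. Qed.

(** A point of [A] outside [B] is comparable with every [y] in [B]: one direction puts [y] in [A],
    the other would put the point in [B]. *)
Lemma rel_closed_chain (r : rel R) A B : total r ->
  rel_closed r A -> rel_closed r B -> A `<=` B \/ B `<=` A.
Proof.
move=> tr cA cB; have [|nAB] := pselect (A `<=` B); [by left|right=> y By].
have [x [Ax nBx]] : exists x, A x /\ ~ B x.
  by apply: contrapT => H; apply: nAB => x Ax; apply: contrapT => nBx; apply: H; exists x.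
have /orP[xy|yx] := tr x y; first exact: cA xy.
by exfalso; apply: nBx; exact: cB yx.
Qed.

(** [stoch_increasing] speaks of open half-lines only; this classification, by boundedness below and
    membership of the infimum, lets it be extended to all up-closed sets. *)
Lemma rel_closed_leP A : rel_closed <=%R A ->
  [\/ A = set0, A = setT, exists u, A = `]u, +oo[%classic | exists u, A = `[u, +oo[%classic].
Proof.
move=> cA; have [->|/set0P[a Aa]] := eqVneq A set0; first by constructor 1.
have [lbA|nlb] := pselect (has_lbound A); last first.
  constructor 2; apply/seteqP; split => // x _.
  apply: contrapT => nAx; apply: nlb; exists x => y Ay.
  by rewrite leNgt; apply/negP => /ltW yx; apply: nAx; exact: cA yx.
have infA : has_inf A by split => //; exists a.
have gt x : inf A < x -> A x.
  by move=> /(inf_lt infA.1) [y Ay /ltW yx]; exact: cA yx.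
have ge x : A x -> inf A <= x by move=> Ax; exact: ge_inf infA.2 _ _.
have [Ai|nAi] := pselect (A (inf A)).
  constructor 4; exists (inf A); apply/seteqP; split => x /=.
    by rewrite in_itv/= andbT; exact: ge.
  by rewrite in_itv/= andbT => ix; exact: cA ix.
constructor 3; exists (inf A); apply/seteqP; split => x /=; rewrite in_itv/= andbT.
  move=> Ax; rewrite lt_neqAle ge// andbT; apply/eqP => E.
  by apply: nAi; rewrite E.
exact: gt.
Qed.

End closed_sets.

Section conditional_mass.
Context {R : realType}.
Local Notation leb := (@lebesgue_measure R).
Implicit Types (h : R -> R -> R) (A : set R).

(** The kernel [P(U in A | V = v)], extending [cond_gt] and [cond_le] to arbitrary sets; it is 0
    where [density_V h v] is not positive. *)
Definition cond_mass h A v : R := \int[leb]_(x in A) cond_density h x v.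

Section one_density.
Variable h : R -> R -> R.
Hypothesis dh : bivariate_density h.

Let h_meas : measurable_fun [set: R * R] (fun uv => h uv.1 uv.2).
Proof. by case: dh. Qed.

Let h_ge0 u v : 0 <= h u v. Proof. by case: dh. Qed.

Lemma density_V_ge0 v : 0 <= density_V h v.
Proof. by apply: Rintegral_ge0 => x _; exact: h_ge0. Qed.

Lemma cond_density_ge0 u v : 0 <= cond_density h u v.
Proof. by rewrite divr_ge0 ?density_V_ge0. Qed.

Lemma measurable_density_V : measurable_fun setT (density_V h).
Proof.
apply: measurableT_comp; first exact: fine_measurable.
apply: (@measurable_fun_fubini_tonelli_G _ _ _ _ _ leb
  (fun uv : R * R => (h uv.1 uv.2)%:E)).
  exact/measurable_EFinP.
by move=> uv; rewrite lee_fin.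
Qed.

Lemma measurable_cond_density :
  measurable_fun [set: R * R] (fun uv => cond_density h uv.1 uv.2).
Proof.
apply: measurable_funM; first exact: h_meas.
(* On nonnegative reals, 0 included, the inverse is the power with exponent -1, which is known to be
   measurable. *)
rewrite (_ : (fun uv => _) = (fun uv : R * R => density_V h uv.2 `^ (-1))); last first.
  by apply/funext => uv; rewrite powR_inv1// density_V_ge0.
apply: (measurableT_comp (measurable_powR _)).
exact: (measurableT_comp measurable_density_V).
Qed.

Lemma measurable_cond_density_l v : measurable_fun setT (cond_density h ^~ v).
Proof.
exact: (measurableT_comp measurable_cond_density (measurable_pair2 v)).
Qed.

Let emass A v : \bar R := (\int[leb]_(x in A) (cond_density h x v)%:E)%E.

Let emass_ge0 A v : (0 <= emass A v)%E.
Proof. by apply: integral_ge0 => x _; rewrite lee_fin cond_density_ge0. Qed.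

Let emassT v : 0 < density_V h v -> emass setT v = 1%E.
Proof.
move=> v_gt0; rewrite /emass.
(* An infinite integral would be sent to 0 by [fine], against the positivity of [density_V h v]. *)
have fin : (\int[leb]_u (h u v)%:E)%E = (density_V h v)%:E.
  rewrite fineK//; move: v_gt0; rewrite /density_V /Rintegral.
  by case: (integral _ _ _) => [r| |]//=; rewrite ltxx.
under eq_integral => x _ do rewrite /cond_density mulrC EFinM.
rewrite ge0_integralZl_EFin//.
- by rewrite fin -EFinM mulVf// gt_eqF.
- by move=> x _; rewrite lee_fin.
- apply/measurable_EFinP.
  exact: (measurableT_comp h_meas (measurable_pair2 v)).
- by rewrite invr_ge0 ltW.
Qed.

Let emass_bad A v : ~ 0 < density_V h v -> emass A v = 0%E.
Proof.
move=> v0; rewrite /emass integral0_eq// => x _.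
have /eqP v_eq0 : density_V h v == 0.
  by move/negP: v0; rewrite lt0r density_V_ge0 andbT negbK.
by rewrite /cond_density v_eq0 invr0 mulr0.
Qed.

Let emass_le1 A v : measurable A -> (emass A v <= 1)%E.
Proof.
move=> mA; have [v0|v0] := pselect (0 < density_V h v); last by rewrite emass_bad.
rewrite -(emassT v v0); apply: ge0_subset_integral => //.
  by apply/measurable_EFinP; exact: measurable_cond_density_l.
by move=> x _; rewrite lee_fin cond_density_ge0.
Qed.

Lemma cond_massE A v : measurable A ->
  (cond_mass h A v)%:E = (\int[leb]_(x in A) (cond_density h x v)%:E)%E.
Proof.
move=> mA; rewrite fineK// ge0_fin_numE ?emass_ge0//.
by rewrite (le_lt_trans (emass_le1 _ _ mA))// ltry.
Qed.

Lemma cond_mass_ge0 A v : 0 <= cond_mass h A v.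
Proof. by rewrite fine_ge0// emass_ge0. Qed.

Lemma cond_massT v : 0 < density_V h v -> cond_mass h setT v = 1.
Proof. by move=> v0; apply: EFin_inj; rewrite cond_massE//; exact: emassT. Qed.

Lemma cond_mass_bad A v : ~ 0 < density_V h v -> cond_mass h A v = 0.
Proof. by move=> v0; rewrite /cond_mass /Rintegral -/(emass A v) emass_bad. Qed.

Lemma cond_mass_le1 A v : measurable A -> cond_mass h A v <= 1.
Proof. by move=> mA; rewrite -lee_fin cond_massE//; exact: emass_le1. Qed.

Lemma cond_massC A v : measurable A -> 0 < density_V h v ->
  cond_mass h (~` A) v + cond_mass h A v = 1.
Proof.
move=> mA v0; have mCA := measurableC mA.
apply: EFin_inj; rewrite EFinD !cond_massE// -(emassT v v0) /emass -(setvU A).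
rewrite ge0_integral_setU//.
- by rewrite setvU; apply/measurable_EFinP; exact: measurable_cond_density_l.
- by move=> x _; rewrite lee_fin cond_density_ge0.
- by apply/disj_set2P; rewrite setICl.
Qed.

Lemma measurable_cond_mass A : measurable A ->
  measurable_fun setT (cond_mass h A).
Proof.
move=> mA; apply: measurableT_comp; first exact: fine_measurable.
(* With the indicator of [A] moved into the integrand, this is a partial integral over a product
   space, measurable by Tonelli. *)
rewrite (_ : (fun v => _) = fubini_G leb
    (fun uv : R * R => (\1_A uv.1 * cond_density h uv.1 uv.2)%:E)); last first.
  apply/funext => v; rewrite /fubini_G [LHS]integral_mkcond/=.
  apply: eq_integral => x _; rewrite patchE indicE.
  by case: ifPn => xA; rewrite ?mul1r ?mul0r.
apply: measurable_fun_fubini_tonelli_G.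
  apply/measurable_EFinP; apply: measurable_funM measurable_cond_density.
  exact: (measurableT_comp (measurable_indic mA)).
by move=> uv; rewrite lee_fin mulr_ge0 ?cond_density_ge0.
Qed.

End one_density.

Definition stoch_monotone (r : rel R) h := forall A v1 v2, rel_closed r A ->
  0 < density_V h v1 -> 0 < density_V h v2 -> r v1 v2 ->
  cond_mass h A v1 <= cond_mass h A v2.

(** The empty set and the line have constant mass, and a closed half-line differs from an open one
    by a Lebesgue-null point. *)
Lemma stoch_increasing_le h : bivariate_density h -> stoch_increasing h ->
  stoch_monotone <=%R h.
Proof.
move=> dh si A v1 v2 /rel_closed_leP[->|->|[u ->]|[u ->]] v10 v20 v12.
- by rewrite /cond_mass !Rintegral_set0.
- by rewrite !cond_massT.
- exact: si.
- have E v : cond_mass h `[u, +oo[ v = cond_gt h u v.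
    rewrite /cond_mass /cond_gt /Rintegral integral_itv_obnd_cbnd//.
    apply: (@measurable_funS _ _ _ _ setT) => //.
    by apply/measurable_EFinP; exact: measurable_cond_density_l.
  by rewrite !E; exact: si.
Qed.

(** The complement of a down-closed set is up-closed, and at valid conditioning values the two
    masses add up to 1. *)
Lemma stoch_increasing_ge h : bivariate_density h -> stoch_increasing h ->
  stoch_monotone >=%R h.
Proof.
move=> dh si A v1 v2 cA v10 v20 v21.
have mA := rel_closed_ge_measurable _ cA.
have := stoch_increasing_le _ dh si _ _ _ (rel_closed_geC _ cA) v20 v10 v21.
have e1 := cond_massC _ dh _ _ mA v10; have e2 := cond_massC _ dh _ _ mA v20.
by rewrite -(lerD2r (cond_mass h A v2)) e2 -e1 lerD2l.
Qed.

End conditional_mass.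

(** * Iterated integrals over tuples *)

Section tuple_integral.
Context {R : realType}.
Local Notation leb := (@lebesgue_measure R).
Local Open Scope ereal_scope.

Lemma eq_integral_tuple m (f g : m.-tuple R -> \bar R) :
  f =1 g -> integral_tuple f = integral_tuple g.
Proof. by move=> /funext ->. Qed.

Lemma integral_tuple0 m : integral_tuple (fun _ : m.-tuple R => 0) = 0 :> \bar R.
Proof.
by elim: m => [//|m IH] /=; rewrite integral0_eq// => x _; rewrite IH.
Qed.

Lemma integral_tupleS m (f : m.+1.-tuple R -> \bar R) :
  integral_tuple f = \int[leb]_x integral_tuple (fun t => f [tuple of x :: t]).
Proof. by []. Qed.

(** The definition peels off the first, outermost variable, whereas conditional densities are
    integrated from the last one. The order of integration is unchanged, so no Fubini argument is
    involved. *)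
Lemma integral_tuple_rcons m (f : m.+1.-tuple R -> \bar R) :
  integral_tuple f =
  integral_tuple (fun t : m.-tuple R => \int[leb]_x f [tuple of rcons t x]).
Proof.
elim: m f => [|m IH] f.
  by rewrite integral_tupleS; apply: eq_integral => x _; congr f; apply: val_inj.
rewrite integral_tupleS [RHS]integral_tupleS.
apply: eq_integral => x _; rewrite IH; apply: eq_integral_tuple => t.
by apply: eq_integral => y _; congr f; apply: val_inj.
Qed.

(** A hyperplane is null: the integral in coordinate [j] only sees the single point [b]. *)
Lemma integral_tuple_null m (f : m.-tuple R -> \bar R) (j : 'I_m) b :
  (forall z, tnth z j <> b -> f z = 0) -> integral_tuple f = 0.
Proof.
elim: m f j => [|m IH] f j f0; first by case: j {f0}.
have [j0|[i ji]] : j = ord0 \/ exists i, j = lift ord0 i.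
  by case: (unliftP ord0 j) => [i|] ->; [right; exists i|left].
- have E x : x != b -> integral_tuple (fun t => f [tuple of x :: t]) = 0.
    move=> /eqP xb; rewrite -[RHS](integral_tuple0 m).
    by apply: eq_integral_tuple => t; apply: f0; rewrite j0 tnth0.
  rewrite -(integral_set1 (fun x => integral_tuple (fun t => f [tuple of x :: t])) b).
  rewrite [RHS]integral_mkcond/=; apply: eq_integral => x _; rewrite patchE.
  by case: ifPn => //; rewrite notin_setE => /eqP/E.
- rewrite /= integral0_eq// => x _; apply: (IH _ i) => z zb; apply: f0.
  by rewrite ji tnthS.
Qed.

(** Makes almost-everywhere reasoning available for iterated integrals. The measure is the image
    under cons of the product of Lebesgue measure with the measure one dimension lower, and Tonelli
    identifies the integrals. *)
Lemma integral_tuple_measure m :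
  exists lam : {sigma_finite_measure set (m.-tuple R) -> \bar R},
  forall f : m.-tuple R -> \bar R, measurable_fun setT f -> (forall z, 0 <= f z) ->
    integral_tuple f = \int[lam]_z f z.
Proof.
elim: m => [|m [lam IH]].
  exists (\d_([tuple] : 0.-tuple R)) => f mf f0 /=.
  by rewrite integral_dirac// diracT mul1e.
pose cons_pair (p : R * m.-tuple R) := [tuple of p.1 :: p.2] : m.+1.-tuple R.
have mcons : measurable_fun [set: measurableTypeR R * m.-tuple R] cons_pair.
  exact: (@measurable_cons _ _ _ R fst m snd).
pose leb' : {sigma_finite_measure set (measurableTypeR R) -> \bar R} := leb.
pose prod : {measure set (measurableTypeR R * m.-tuple R) -> \bar R} := leb' \x lam.
pose push : {measure set (m.+1.-tuple R) -> \bar R} :=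
  pushforward prod cons_pair.
pose mu := push mcons.
(* The boxes [F k] times [G k], pulled back along [uncons], have finite measure and cover everything
   because both sequences increase. *)
have mu_sf : sigma_finite setT mu.
  have /sigma_finiteP[F [FT Fmono Ffin]] := sigma_finiteT leb'.
  have /sigma_finiteP[G [GT Gmono Gfin]] := sigma_finiteT lam.
  pose uncons (t : m.+1.-tuple R) : R * m.-tuple R := (thead t, [tuple of behead t]).
  have muncons : measurable_fun setT uncons.
    apply: measurable_fun_pair; first exact: measurable_tnth.
    exact: measurable_behead.
  have consK : cancel cons_pair uncons.
    by move=> [x t]; rewrite /uncons/= theadE; congr pair; apply: val_inj.
  exists (fun k => uncons @^-1` (F k `*` G k)).
    apply/seteqP; split => // t _.
    have [i _ Fi] : (\bigcup_i F i) (uncons t).1 by rewrite -FT.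
    have [j _ Gj] : (\bigcup_i G i) (uncons t).2 by rewrite -GT.
    exists (maxn i j) => //; split.
      by have /subsetPset := Fmono _ _ (leq_maxl i j); apply.
    by have /subsetPset := Gmono _ _ (leq_maxr i j); apply.
  move=> k; have [mF muF] := Ffin k; have [mG muG] := Gfin k; split.
    by rewrite -[X in measurable X]setTI; apply: muncons => //; exact: measurableX.
  rewrite /mu /push /= /pushforward -comp_preimage (_ : uncons \o cons_pair = id).
    by rewrite preimage_id product_measure1E// lte_mul_pinfty// ge0_fin_numE.
  by apply/funext => p; exact: consK.
pose sf := Measure_isSigmaFinite.Build _ _ _ _ mu_sf.
pose nu : {sigma_finite_measure set (m.+1.-tuple R) -> \bar R} := 
  HB.pack (Measure.sort mu) sf.
exists nu => f mf f0; rewrite integral_tupleS.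
have E := @ge0_integral_pushforward _ _ _ _ _ _ mcons
  prod setT f measurableT mf (fun y _ => f0 y).
have E' := @fubini_tonelli1 _ _ _ _ _ leb' lam (f \o cons_pair)
  (measurableT_comp mf mcons) (fun p => f0 (cons_pair p)).
rewrite preimage_setT in E; apply: (etrans _ (esym (etrans E E'))).
apply: eq_integral => x _; rewrite IH//.
have mx : measurable_fun setT (fun t : m.-tuple R => [tuple of x :: t] : m.+1.-tuple R).
  exact: (@measurable_cons _ _ _ R (fun=> x) m id (@measurable_cst _ _ _ _ _ _) (@measurable_id _ _ _)).
exact: (measurableT_comp mf mx).
Qed.

End tuple_integral.

Definition tuple_measure (R : realType) (m : nat) :
    {sigma_finite_measure set (m.-tuple R) -> \bar R} :=
  projT1 (cid (@integral_tuple_measure R m)).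

Lemma integral_tupleE (R : realType) (m : nat) (f : m.-tuple R -> R) :
  measurable_fun setT f -> (forall z, 0 <= f z) ->
  integral_tuple (fun z => (f z)%:E) = (\int[tuple_measure R m]_z (f z)%:E)%E.
Proof.
move=> mf f0; apply: (projT2 (cid (@integral_tuple_measure R m))).
  exact/measurable_EFinP.
by move=> z; rewrite lee_fin.
Qed.

Lemma integral_tuple_eq0 (R : realType) (m : nat) (f : m.-tuple R -> R) :
  measurable_fun setT f -> (forall z, 0 <= f z) ->
  integral_tuple (fun z => (f z)%:E) = 0%E <->
  {ae tuple_measure R m, forall z, f z = 0}.
Proof.
move=> mf f0; rewrite integral_tupleE//.
have -> : (\int[tuple_measure R m]_z (f z)%:E = \int[tuple_measure R m]_z `|(f z)%:E|)%E.
  by apply: eq_integral => z _; rewrite gee0_abs// lee_fin.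
rewrite ae_eq_integral_abs//; last exact/measurable_EFinP.
split; apply: filterS => z; first by move=> /(_ I)[].
by move=> -> _.
Qed.

(** Reading a tuple through [nth 0] makes it a trajectory [nat -> R]; past its length the coordinate
    is the constant 0. *)
Lemma measurable_nth (R : realType) (m i : nat) :
  measurable_fun setT (fun z : m.-tuple R => nth 0 z i).
Proof.
have [im|mi] := ltnP i m.
  rewrite (_ : (fun z => _) = (fun z : m.-tuple R => tnth z (Ordinal im))).
    exact: measurable_tnth.
  by apply/funext => z; rewrite (tnth_nth 0).
rewrite (_ : (fun z => _) = cst 0)//.
by apply/funext => z; rewrite nth_default// size_tuple.
Qed.

(** * Sequences with mixture transition densities *)

Section mixture_sequence.
Context {R : realType} {L : nat}.
Local Notation leb := (@lebesgue_measure R).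
Variables (f1 : R -> R) (h : nat -> 'I_L -> R -> R -> R).
Variables (act : nat -> pred 'I_L) (w : nat -> 'I_L -> R) (pa : nat -> 'I_L -> nat).
Variable N : nat.

Hypothesis f1_meas : measurable_fun setT f1.
Hypothesis f1_ge0 : forall x, 0 <= f1 x.
Hypothesis f1_int : (\int[leb]_x (f1 x)%:E = 1)%E.
Hypothesis dh : forall i l, (0 < i < N)%N -> act i l -> bivariate_density (h i l).
Hypothesis w_ge0 : forall i l, (0 < i < N)%N -> act i l -> 0 <= w i l.
Hypothesis w_sum : forall i, (0 < i < N)%N -> \sum_(l < L | act i l) w i l = 1.
Hypothesis pa_lt : forall i l, (0 < i < N)%N -> act i l -> (pa i l < i)%N.

(* [act i l] says that the component [l] is present at time [i], and [pa i l < i]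
   is its parent; [z : nat -> R] is a trajectory. *)
Definition mix_density i (x : R) (z : nat -> R) : R :=
  if i == 0%N then f1 x
  else \sum_(l < L | act i l) w i l * cond_density (h i l) x (z (pa i l)).

Definition seq_density m (z : nat -> R) : R := \prod_(i < m) mix_density i (z i) z.

(** For [i > 0], the conditional probability that the [i]-th value lies in [A] given the past. *)
Definition mix_mass i (A : set R) (z : nat -> R) : R :=
  \sum_(l < L | act i l) w i l * cond_mass (h i l) A (z (pa i l)).

Definition rect_indic m (B : nat -> set R) (z : nat -> R) : R :=
  \prod_(i < m) \1_(B i) (z i).

(** The mass that the first [m] factors give to a rectangle. It is not yet the law of the first [m]
    variables, since later factors could lose mass. *)
Definition rect_mass m (B : nat -> set R) : \bar R :=
  integral_tuple (fun t : m.-tuple R =>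
    (rect_indic m B (nth 0 t) * seq_density m (nth 0 t))%:E).

Lemma mix_density_ge0 i x z : (i < N)%N -> 0 <= mix_density i x z.
Proof.
move=> iN; rewrite /mix_density; case: eqP => // /eqP; rewrite -lt0n => i0.
have i0N : (0 < i < N)%N by rewrite i0.
apply: sumr_ge0 => l al; rewrite mulr_ge0 ?w_ge0//.
exact: (cond_density_ge0 _ (dh _ _ i0N al)).
Qed.

Lemma seq_density_ge0 m z : (m <= N)%N -> 0 <= seq_density m z.
Proof.
move=> mN; apply: prodr_ge0 => i _; apply: mix_density_ge0.
exact: leq_trans (ltn_ord i) mN.
Qed.

Lemma mix_mass_ge0 i A z : (0 < i < N)%N -> 0 <= mix_mass i A z.
Proof.
move=> iN; apply: sumr_ge0 => l al.
by rewrite mulr_ge0 ?w_ge0// (cond_mass_ge0 _ (dh _ _ iN al)).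
Qed.

Lemma mix_mass_le1 i A z : (0 < i < N)%N -> measurable A -> mix_mass i A z <= 1.
Proof.
move=> iN mA; rewrite -(w_sum i iN); apply: ler_sum => l al.
by rewrite ler_piMr ?w_ge0// (cond_mass_le1 _ (dh _ _ iN al)).
Qed.

Lemma rect_indic_ge0 m B z : 0 <= rect_indic m B z.
Proof. exact: prodr_ge0. Qed.

Lemma rect_indicE m B z : rect_indic m B z <> 0 ->
  rect_indic m B z = 1 /\ forall i, (i < m)%N -> B i (z i).
Proof.
move=> /eqP/prodf_neq0 nz.
have Bz (i : 'I_m) : B i (z i).
  have := nz i isT; rewrite indicE; case: (boolP (_ \in _)); last by rewrite eqxx.
  by rewrite inE.
split; last by move=> i im; exact: (Bz (Ordinal im)).
by apply: big1 => i _; rewrite indicE mem_set.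
Qed.

Lemma rect_indic_eq1 m B z : (forall i, (i < m)%N -> B i (z i)) ->
  rect_indic m B z = 1.
Proof. by move=> Bz; apply: big1 => i _; rewrite indicE mem_set//; exact: Bz. Qed.

Lemma rect_indicT m z : rect_indic m (fun=> setT) z = 1.
Proof. by apply: rect_indic_eq1. Qed.

Lemma measurable_rect_indic m B : (forall i, measurable (B i)) ->
  measurable_fun setT (fun t : m.-tuple R => rect_indic m B (nth 0 t)).
Proof.
move=> mB; apply: measurable_prod => i _.
exact: (measurableT_comp (measurable_indic (mB i)) (measurable_nth _ _ _)).
Qed.

Lemma measurable_mix_density m i : (i < N)%N ->
  measurable_fun setT (fun t : m.-tuple R => mix_density i (nth 0 t i) (nth 0 t)).
Proof.
move=> iN; rewrite /mix_density; case: eqP => [_|/eqP].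
  exact: (measurableT_comp f1_meas (measurable_nth _ _ _)).
rewrite -lt0n => i0; have i0N : (0 < i < N)%N by rewrite i0.
under eq_fun do rewrite big_mkcond /=.
apply: measurable_sum => l.
have [al|nal] := boolP (act i l); last exact: measurable_cst.
apply: measurable_funM => //.
apply: (measurableT_comp (measurable_cond_density _ (dh _ _ i0N al))
  (measurable_fun_pair (measurable_nth _ _ _) (measurable_nth _ _ _))).
Qed.

Lemma measurable_seq_density m : (m <= N)%N ->
  measurable_fun setT (fun t : m.-tuple R => seq_density m (nth 0 t)).
Proof.
move=> mN; apply: measurable_prod => i _; apply: measurable_mix_density.
exact: leq_trans (ltn_ord i) mN.
Qed.

Lemma measurable_mix_mass m i A : (0 < i < N)%N -> measurable A ->
  measurable_fun setT (fun t : m.-tuple R => mix_mass i A (nth 0 t)).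
Proof.
move=> iN mA; rewrite /mix_mass.
under eq_fun do rewrite big_mkcond/=.
apply: measurable_sum => l.
have [al|nal] := boolP (act i l); last exact: measurable_cst.
apply: measurable_funM => //.
exact: (measurableT_comp (measurable_cond_mass _ (dh _ _ iN al) _ mA)
  (measurable_nth _ _ _)).
Qed.

Lemma integral_mix_density i A z : (0 < i < N)%N -> measurable A ->
  (\int[leb]_(x in A) (mix_density i x z)%:E = (mix_mass i A z)%:E)%E.
Proof.
move=> iN mA; have /andP[i0 _] := iN.
rewrite /mix_density gtn_eqF//.
pose F l x := if act i l then w i l * cond_density (h i l) x (z (pa i l)) else 0.
transitivity (\int[leb]_(x in A) \sum_(l <- index_enum 'I_L) (F l x)%:E)%E.
  by apply: eq_integral => x _; rewrite sumEFin [in LHS]big_mkcond.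
rewrite ge0_integral_sum//.
- rewrite /mix_mass [in RHS]big_mkcond -sumEFin; apply: eq_bigr => l _.
  rewrite /F; case: ifPn => al; last by rewrite integral0.
  rewrite EFinM (cond_massE _ (dh _ _ iN al))// -ge0_integralZl_EFin//.
  + by move=> x _; rewrite lee_fin (cond_density_ge0 _ (dh _ _ iN al)).
  + apply: (@measurable_funS _ _ _ _ setT) => //; apply/measurable_EFinP.
    exact: (measurable_cond_density_l _ (dh _ _ iN al)).
  + exact: w_ge0.
- move=> l; apply: (@measurable_funS _ _ _ _ setT) => //; apply/measurable_EFinP.
  rewrite /F; have [al|nal] := boolP (act i l); last exact: measurable_cst.
apply: measurable_funM => //.
  exact: (measurable_cond_density_l _ (dh _ _ iN al)).
- move=> l x _; rewrite lee_fin /F; case: ifPn => // al.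
  by rewrite mulr_ge0 ?w_ge0// (cond_density_ge0 _ (dh _ _ iN al)).
Qed.

Lemma measurable_mix_density_l i z : (0 < i < N)%N ->
  measurable_fun setT (mix_density i ^~ z).
Proof.
move=> iN; have /andP[i0 _] := iN; rewrite /mix_density gtn_eqF//.
under eq_fun do rewrite big_mkcond/=.
apply: measurable_sum => l; have [al|nal] := boolP (act i l); last exact: measurable_cst.
apply: measurable_funM => //.
exact: (measurable_cond_density_l _ (dh _ _ iN al)).
Qed.

Lemma mix_density_ext i x z z' : (i < N)%N -> (forall j, (j < i)%N -> z j = z' j) ->
  mix_density i x z = mix_density i x z'.
Proof.
move=> iN zz'; rewrite /mix_density; case: eqP => // /eqP; rewrite -lt0n => i0.
by apply: eq_bigr => l al; rewrite zz'// pa_lt ?i0.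
Qed.

Lemma rect_massS m B : (0 < m < N)%N -> (forall i, measurable (B i)) ->
  rect_mass m.+1 B = integral_tuple (fun t : m.-tuple R =>
    (rect_indic m B (nth 0 t) * seq_density m (nth 0 t) * mix_mass m (B m) (nth 0 t))%:E).
Proof.
move=> mN mB; have /andP[_ mN'] := mN.
rewrite /rect_mass integral_tuple_rcons; apply: eq_integral_tuple => t /=.
have tj x j : (j < m)%N -> nth 0 (rcons t x) j = nth 0 t j.
  by move=> jm; rewrite nth_rcons size_tuple jm.
have tm x : nth 0 (rcons t x) m = x by rewrite nth_rcons size_tuple ltnn eqxx.
rewrite EFinM -integral_mix_density//.
rewrite -ge0_integralZl_EFin//; last 3 first.
- by move=> x _; rewrite lee_fin mix_density_ge0.
- apply: (@measurable_funS _ _ _ _ setT) => //; apply/measurable_EFinP.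
  exact: measurable_mix_density_l.
- by rewrite mulr_ge0 ?rect_indic_ge0 ?seq_density_ge0// ltnW.
rewrite [RHS]integral_mkcond; apply: eq_integral => x _; rewrite patchE.
rewrite /rect_indic /seq_density !big_ord_recr/= tm.
rewrite (eq_bigr (fun i : 'I_m => \1_(B i) (nth 0 t i))); last first.
  by move=> i _; rewrite tj.
(* Parents precede their children, so the first [m] factors ignore the new coordinate and leave the
   inner integral. *)
rewrite [X in _ * (X * _)](eq_bigr (fun i : 'I_m => mix_density i (nth 0 t i) (nth 0 t))); last first.
  move=> i _; rewrite tj//; apply: mix_density_ext.
    exact: ltn_trans (ltn_ord i) mN'.
  by move=> j ji; rewrite tj// (ltn_trans ji).
have -> : mix_density m x (nth 0 (rcons t x)) = mix_density m x (nth 0 t).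
  apply: mix_density_ext => // j jm; exact: tj.
rewrite indicE; case: ifPn => _ /=; last by rewrite mulr0 mul0r.
by rewrite mulr1 -EFinM mulrA.
all: exact: mB.
Qed.

Let lam m := tuple_measure R m.

Lemma measurable_rect_density m B : (m <= N)%N -> (forall i, measurable (B i)) ->
  measurable_fun setT (fun t : m.-tuple R =>
    rect_indic m B (nth 0 t) * seq_density m (nth 0 t)).
Proof.
move=> mN mB; apply: measurable_funM; first exact: measurable_rect_indic.
exact: measurable_seq_density.
Qed.

Lemma measurable_rect_mix m B A : (0 < m < N)%N -> (forall i, measurable (B i)) ->
  measurable A ->
  measurable_fun setT (fun t : m.-tuple R =>
    rect_indic m B (nth 0 t) * seq_density m (nth 0 t) * mix_mass m A (nth 0 t)).
Proof.
move=> mN mB mA; apply: measurable_funM; last exact: measurable_mix_mass.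
by apply: measurable_rect_density => //; case/andP: mN => _ /ltnW.
Qed.

Lemma rect_density_ge0 m B z : (m <= N)%N -> 0 <= rect_indic m B z * seq_density m z.
Proof. by move=> mN; rewrite mulr_ge0 ?rect_indic_ge0 ?seq_density_ge0. Qed.

Lemma rect_mix_ge0 m B A z : (0 < m < N)%N ->
  0 <= rect_indic m B z * seq_density m z * mix_mass m A z.
Proof.
move=> mN; rewrite mulr_ge0 ?mix_mass_ge0// rect_density_ge0//.
by case/andP: mN => _ /ltnW.
Qed.

(** The mass starts at 1 with [f1], and each further factor integrates to [mix_mass m setT], which
    is at most 1 and smaller when a parent of positive weight is invalid. *)
Lemma rect_massT_le1 m : (0 < m <= N)%N -> (rect_mass m (fun=> setT) <= 1)%E.
Proof.
elim: m => [//|[_ _|m IH mN]].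
  rewrite -f1_int /rect_mass integral_tupleS.
  under eq_integral => x _ do
    rewrite /= /rect_indic /seq_density !big_ord1 indicT mul1r /mix_density/=.
  exact: lexx.
have mN' : (0 < m.+1 < N)%N by [].
have mN1 : (m.+1 <= N)%N by rewrite ltnW.
apply: (le_trans _ (IH _)) => //.
rewrite rect_massS// /rect_mass !integral_tupleE//.
- apply: ge0_le_integral => //.
  + by move=> t _; rewrite lee_fin rect_mix_ge0.
  + by apply/measurable_EFinP; apply: measurable_rect_mix.
  + by apply/measurable_EFinP; apply: measurable_rect_density.
  + by move=> t _; rewrite lee_fin ler_piMr ?rect_density_ge0// mix_mass_le1.
- exact: measurable_rect_density.
- by move=> t; exact: rect_density_ge0.
- exact: measurable_rect_mix.
- by move=> t; exact: rect_mix_ge0.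
Qed.

(** The weighted deficits are nonnegative and sum to 0, so each vanishes; an invalid parent would
    leave a deficit equal to its weight. *)
Lemma mix_massT_eq1 m z : (0 < m < N)%N -> mix_mass m setT z = 1 ->
  forall l, act m l -> 0 < w m l -> 0 < density_V (h m l) (z (pa m l)).
Proof.
move=> mN; rewrite -(w_sum m mN) => E l al wl; apply: contrapT => bad.
have : \sum_(k < L | act m k) w m k * (1 - cond_mass (h m k) setT (z (pa m k))) = 0.
  under eq_bigr do rewrite mulrBr mulr1.
  by rewrite sumrB -E subrr.
move/eqP; rewrite psumr_eq0; last first.
  move=> k ak; rewrite mulr_ge0 ?w_ge0// subr_ge0.
  by rewrite (cond_mass_le1 _ (dh _ _ mN ak)).
move/allP => /(_ l (mem_index_enum l)); rewrite al/= cond_mass_bad ?subr0 ?mulr1//.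
  by rewrite gt_eqF.
exact: dh.
Qed.

(** * Random sequences with the mixture density *)

Context {d} {T : measurableType d} {P : probability T R}.
Variable Y : nat -> {RV P >-> R}.

Definition rect_event m (B : nat -> set R) : set T :=
  [set t | forall i, (i < m)%N -> B i (Y i t)].

Lemma rect_eventE m B : rect_event m B = \bigcap_(i in `I_m) (Y i @^-1` B i).
Proof. by apply/seteqP; split. Qed.

Lemma measurable_rect_event m B : (forall i, measurable (B i)) ->
  measurable (rect_event m B).
Proof.
move=> mB; rewrite rect_eventE; apply: fin_bigcap_measurable => // i _.
by rewrite -[X in measurable X]setTI; exact: measurable_funP.
Qed.

Definition has_rect_mass m := forall B, (forall i, measurable (B i)) ->
  P (rect_event m B) = rect_mass m B.

Definition good_parents m := {ae lam m, forall t : m.-tuple R,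
  seq_density m (nth 0 t) <> 0 -> forall l, act m l -> 0 < w m l ->
    0 < density_V (h m l) (nth 0 t (pa m l))}.

(* The last factor integrates to [mix_mass m setT <= 1]; as the total mass is 1,
   equality holds almost everywhere. *)
Lemma has_rect_mass_pred m : (0 < m < N)%N -> has_rect_mass m.+1 ->
  has_rect_mass m /\ good_parents m.
Proof.
move=> mN PE; have /andP[m0 mN'] := mN; have mN1 := ltnW mN'.
pose g (t : m.-tuple R) := seq_density m (nth 0 t).
pose k (t : m.-tuple R) := mix_mass m setT (nth 0 t).
have mg : measurable_fun setT g by exact: measurable_seq_density.
have mk : measurable_fun setT k by exact: measurable_mix_mass.
have g0 t : 0 <= g t by exact: seq_density_ge0.
have k0 t : 0 <= k t by exact: mix_mass_ge0.
have k1 t : 0 <= 1 - k t by rewrite subr_ge0 mix_mass_le1.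
have gk1 : (\int[lam m]_t (g t * k t)%:E = 1)%E.
  have := PE (fun=> setT) (fun=> measurableT).
  rewrite (_ : rect_event _ _ = setT); last by apply/seteqP; split.
  rewrite probability_setT rect_massS// integral_tupleE.
  - move=> ->; apply: eq_integral => t _.
    by rewrite rect_indicT mul1r.
  - exact: measurable_rect_mix.
  - by move=> t; exact: rect_mix_ge0.
have g1 : (\int[lam m]_t (g t)%:E <= 1)%E.
  have := @rect_massT_le1 m; rewrite m0 => /(_ mN1); rewrite /rect_mass.
  under eq_integral_tuple do rewrite rect_indicT mul1r.
  by rewrite integral_tupleE.
(* This integral and that of [g t * k t] add up to the integral of [g], which is at most 1, while
   the latter is already 1. *)
have gk0 : (\int[lam m]_t (g t * (1 - k t))%:E = 0)%E.
  have : (\int[lam m]_t (g t * k t)%:E + \int[lam m]_t (g t * (1 - k t))%:E <= 1)%E.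
    rewrite -ge0_integralD//.
    - by under eq_integral do rewrite -EFinD -mulrDr addrC subrK mulr1.
    - by move=> t _; rewrite lee_fin mulr_ge0.
    - by apply/measurable_EFinP; exact: measurable_funM.
    - by move=> t _; rewrite lee_fin mulr_ge0.
    - by apply/measurable_EFinP; apply: measurable_funM => //; exact: measurable_funB.
  rewrite gk1 -[leRHS]adde0 leeD2lE//.
  move=> le0; apply/eqP; rewrite eq_le le0/=.
  by apply: integral_ge0 => t _; rewrite lee_fin mulr_ge0.
have ae1 : {ae lam m, forall t, g t * (1 - k t) = 0}.
  apply/integral_tuple_eq0.
  - by apply: measurable_funM => //; exact: measurable_funB.
  - by move=> t; rewrite mulr_ge0.
  - rewrite integral_tupleE//; first by apply: measurable_funM => //; exact: measurable_funB.
    by move=> t; rewrite mulr_ge0.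
split.
(* With coordinate [m] left free, the event is one about [m.+1] coordinates, whose extra factor [k]
   is almost everywhere 1 where [g] is nonzero. *)
- move=> B mB; pose B' i := if i == m then setT else B i.
  have mB' i : measurable (B' i) by rewrite /B'; case: eqP.
  have -> : rect_event m B = rect_event m.+1 B'.
    apply/seteqP; split => t tB i.
      by rewrite ltnS leq_eqVlt /B'; case: eqP => //= _; exact: tB.
    by move=> im; have := tB i (ltnW im); rewrite /B' ltn_eqF.
  rewrite PE// rect_massS//.
  rewrite integral_tupleE; [|exact: measurable_rect_mix|by move=> t; exact: rect_mix_ge0].
  rewrite /rect_mass integral_tupleE; [|exact: measurable_rect_density|
    by move=> t; exact: rect_density_ge0].
  apply: ge0_ae_eq_integral => //.
  + by apply/measurable_EFinP; exact: measurable_rect_mix.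
  + by apply/measurable_EFinP; exact: measurable_rect_density.
  + by move=> t _; rewrite lee_fin rect_mix_ge0.
  + by move=> t _; rewrite lee_fin rect_density_ge0.
  + apply: filterS ae1 => t /eqP gk _; congr EFin.
    have -> : rect_indic m B' (nth 0 t) = rect_indic m B (nth 0 t).
      by apply: eq_bigr => i _; rewrite /B' ltn_eqF.
    have -> : B' m = setT by rewrite /B' eqxx.
    move: gk; rewrite mulf_eq0 => /orP[/eqP gt0|]; first by rewrite -/(g t) gt0 mulr0 mul0r.
    by rewrite subr_eq0 => /eqP kt; rewrite -/(k t) -kt mulr1.
- apply: filterS ae1 => t /eqP; rewrite mulf_eq0 => /orP[/eqP //|].
  rewrite subr_eq0 => /eqP kt _; exact: mix_massT_eq1.
Qed.

Hypothesis Y_density : has_joint_density (fun i : 'I_N => Y i)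
  (fun t : N.-tuple R => seq_density N (nth 0 t)).

Lemma has_rect_mass_full : has_rect_mass N.
Proof.
move=> B mB; have := Y_density (fun i => B i) (fun i => mB i).
rewrite (_ : [set t | _] = rect_event N B); last first.
  apply/seteqP; split => t tB i; last exact: tB.
  by move=> iN; exact: (tB (Ordinal iN)).
move=> ->; apply: eq_integral_tuple => t; congr (_ * _)%:E.
by apply: eq_bigr => i _; rewrite (tnth_nth 0).
Qed.

(** Downward induction from [N], as only the full joint density is given; the induction variable is
    the number [N - m] of variables dropped. *)
Lemma has_rect_mass_le m : (0 < m <= N)%N -> has_rect_mass m.
Proof.
move=> /andP[m0 mN]; rewrite -(subKn mN).
have : (N - m < N)%N by rewrite ltn_subrL m0 (leq_trans m0).
elim: (N - m)%N => [_|k IH kN]; first by rewrite subn0; exact: has_rect_mass_full.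
have lt0 : (0 < N - k.+1 < N)%N.
  by rewrite subn_gt0 kN ltn_subrL (leq_trans _ kN).
apply: (has_rect_mass_pred _ lt0 _).1; rewrite subnSK ?(ltnW kN)//.
by apply: IH; exact: ltnW.
Qed.

Lemma parents_good m : (0 < m < N)%N -> good_parents m.
Proof.
move=> mN; have /andP[_ mN'] := mN.
exact: (has_rect_mass_pred _ mN (has_rect_mass_le m.+1 mN')).2.
Qed.

Lemma rect_event_integral m B : (0 < m <= N)%N -> (forall i, measurable (B i)) ->
  P (rect_event m B) = (\int[lam m]_t
    (rect_indic m B (nth 0 t) * seq_density m (nth 0 t))%:E)%E.
Proof.
move=> mN mB; have /andP[_ mN'] := mN; rewrite has_rect_mass_le//.
rewrite /rect_mass integral_tupleE//; first exact: measurable_rect_density.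
by move=> t; exact: rect_density_ge0.
Qed.

Lemma rect_eventS_integral m B : (0 < m < N)%N -> (forall i, measurable (B i)) ->
  P (rect_event m.+1 B) = (\int[lam m]_t (rect_indic m B (nth 0 t) *
    seq_density m (nth 0 t) * mix_mass m (B m) (nth 0 t))%:E)%E.
Proof.
move=> mN mB; have /andP[_ mN'] := mN.
rewrite (has_rect_mass_le m.+1 mN')// rect_massS//.
rewrite integral_tupleE//; first exact: measurable_rect_mix.
by move=> t; exact: rect_mix_ge0.
Qed.

Lemma coordinate_null j b : (j < N)%N -> P [set t | Y j t = b] = 0%E.
Proof.
move=> jN; pose B i := if i == j then [set b] else setT.
have mB i : measurable (B i) by rewrite /B; case: eqP.
rewrite (_ : [set t | _] = rect_event N B); last first.
  apply/seteqP; split => t.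
    by move=> /= tb i iN; rewrite /B; case: eqP => // ->.
  by move=> /(_ j jN); rewrite /B eqxx.
rewrite has_rect_mass_full//; apply: (@integral_tuple_null _ _ _ (Ordinal jN) b) => z.
rewrite (tnth_nth 0)/= => zb; rewrite /rect_indic (bigD1 (Ordinal jN))//=.
by rewrite indicE /B eqxx memNset ?mul0r.
Qed.

(** * Monotone kernels: lower bounds and positivity of tail events *)

Variable r : rel R.
Hypothesis r_refl : reflexive r.
Hypothesis r_trans : transitive r.
Hypothesis r_total : total r.
Hypothesis r_meas : forall A, rel_closed r A -> measurable A.
Hypothesis h_mono : forall i l, (0 < i < N)%N -> act i l -> stoch_monotone r (h i l).

(** On the rectangle, each parent of positive weight is almost surely valid and lies beyond [b l]
    for [r], so its kernel gives [A] at least the mass seen from [b l]; then integrate. *)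
Lemma rect_event_ge m B A (b : 'I_L -> R) : (0 < m < N)%N ->
  (forall i, measurable (B i)) -> rel_closed r A ->
  (forall l x, act m l -> B (pa m l) x -> r (b l) x) ->
  ((\sum_(l < L | act m l) w m l * cond_mass (h m l) A (b l))%:E *
     P (rect_event m B) <= P (rect_event m B `&` [set t | A (Y m t)]))%E.
Proof.
move=> mN mB cA bB; have /andP[m0 mN'] := mN; have mN1 := ltnW mN'.
have mA := r_meas _ cA; set c := \sum_(l < L | _) _.
have c0 : 0 <= c.
  by apply: sumr_ge0 => l al; rewrite mulr_ge0 ?w_ge0// (cond_mass_ge0 _ (dh _ _ mN al)).
pose B' i := if i == m then A else B i.
have mB' i : measurable (B' i) by rewrite /B'; case: eqP.
have -> : rect_event m B `&` [set t | A (Y m t)] = rect_event m.+1 B'.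
  apply/seteqP; split => t.
    move=> [tB tA] i; rewrite ltnS leq_eqVlt /B'.
    by case: eqP => [->//|_]/=; exact: tB.
  move=> tB; split=> [i im|]; last by have := tB m (ltnSn m); rewrite /B' eqxx.
  by have := tB i (ltnW im); rewrite /B' ltn_eqF.
rewrite rect_event_integral// ?m0// rect_eventS_integral//.
have -> : B' m = A by rewrite /B' eqxx.
rewrite -ge0_integralZl_EFin//; last 2 first.
- by move=> t _; rewrite lee_fin rect_density_ge0.
- by apply/measurable_EFinP; exact: measurable_rect_density.
apply: ae_ge0_le_integral => //.
- by move=> t _; rewrite -EFinM lee_fin mulr_ge0 ?rect_density_ge0.
- apply/measurable_EFinP; apply: measurable_funM => //.
  exact: measurable_rect_density.
- by move=> t _; rewrite lee_fin rect_mix_ge0.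
- by apply/measurable_EFinP; exact: measurable_rect_mix.
apply: filterS (parents_good _ mN) => t good _; rewrite -EFinM lee_fin.
have -> : rect_indic m B' (nth 0 t) = rect_indic m B (nth 0 t).
  by apply: eq_bigr => i _; rewrite /B' ltn_eqF.
have [->|/eqP gt] := eqVneq (seq_density m (nth 0 t)) 0; first by rewrite !mulr0 mul0r.
have [->|/eqP it] := eqVneq (rect_indic m B (nth 0 t)) 0; first by rewrite !mul0r mulr0.
have [-> Bt] := rect_indicE _ _ _ it; rewrite mul1r mulrC ler_wpM2l ?seq_density_ge0//.
apply: ler_sum => l al; have := w_ge0 _ _ mN al; rewrite le_eqVlt.
move=> /orP[/eqP <-|wl]; first by rewrite !mul0r.
rewrite ler_pM2l//; have zl := good gt l al wl.
(* If [b l] is not a valid conditioning value, its kernel is 0 and the comparison is trivial. *)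
have [bl|nbl] := pselect (0 < density_V (h m l) (b l)); last first.
  by rewrite (cond_mass_bad _ (dh _ _ mN al))// (cond_mass_ge0 _ (dh _ _ mN al)).
by apply: (h_mono _ _ mN al) => //; apply: bB => //; apply: Bt; exact: pa_lt.
Qed.

(* Rules out the junk value 0 / 0 = 0 of the tail probabilities. *)
Lemma rect_event_gt0 m B : (0 < m <= N)%N -> (forall i, rel_closed r (B i)) ->
  (forall i, (i < m)%N -> (0 < P [set t | B i (Y i t)])%E) ->
  (0 < P (rect_event m B))%E.
Proof.
elim: m B => [//|[_|m IH]] B mN cB Bgt0.
  rewrite (_ : rect_event 1 B = [set t | B 0%N (Y 0%N t)]); first exact: Bgt0.
  apply/seteqP; split => t; first exact.
  by move=> tB [|//] _.
have mN' : (0 < m.+1 < N)%N by [].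
have mN1 : (0 < m.+1 <= N)%N by apply/andP; split=> //; exact: (ltnW mN).
have mB i := r_meas _ (cB i).
set n := m.+1 in IH mN' mN1 Bgt0 *.
(* The [r]-closure of the valid values from which component [l] reaches [B n] with positive
   probability. *)
pose C l := [set y | exists x, [/\ r x y, 0 < density_V (h n l) x &
  0 < cond_mass (h n l) (B n) x]].
have cC l : rel_closed r (C l).
  move=> y y' [x [xy dx mx]] yy'; exists x; split => //; exact: r_trans yy'.
have mC l := r_meas _ (cC l).
pose only (j : nat) (A : set R) (i : nat) : set R := if i == j then A else setT.
have monly j A i : measurable A -> measurable (only j A i).
  by move=> mA; rewrite /only; case: eqP.
have onlyE k j A : (j < k)%N -> [set t | A (Y j t)] = rect_event k (only j A).
  move=> jk; apply/seteqP; split => t.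
    by move=> tA i _; rewrite /only; case: eqP => // ->.
  by move=> /(_ j jk); rewrite /only eqxx.
(* Otherwise almost every trajectory of nonzero density has all its parents of positive weight
   outside the sets [C l], so [mix_mass n (B n)] vanishes there and [B n] would be null for
   [Y n]. *)
have [l [al wl Cl]] : exists l, [/\ act n l, 0 < w n l &
    (0 < P [set t | C l (Y (pa n l) t)])%E].
  apply: contrapT => H.
  have null l : {ae lam n, forall t : n.-tuple R, act n l -> 0 < w n l ->
      rect_indic n (only (pa n l) (C l)) (nth 0 t) * seq_density n (nth 0 t) = 0}.
    have [al|] := boolP (act n l); last by move=> _; apply: aeW => t.
    have [wl|] := boolP (0 < w n l); last by move=> _; apply: aeW => t.
    have mo i : measurable (only (pa n l) (C l) i) by exact: monly.
    have P0 : P [set t | C l (Y (pa n l) t)] = 0%E.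
      apply/eqP; rewrite eq_le measure_ge0 andbT leNgt; apply/negP => Cl.
      by apply: H; exists l.
    have /integral_tuple_eq0 : integral_tuple (fun t : n.-tuple R =>
        (rect_indic n (only (pa n l) (C l)) (nth 0 t) * seq_density n (nth 0 t))%:E) = 0%E.
      by rewrite -P0 (onlyE n) ?pa_lt// has_rect_mass_le.
    move=> ae0; apply: filterS (ae0 _ _) => [t -> //||t].
      by apply: measurable_rect_density => //; case/andP: mN1.
    by apply: rect_density_ge0; case/andP: mN1.
  have mo i : measurable (only n (B n) i) by exact: monly.
  have := Bgt0 n (ltnSn n); rewrite (onlyE n.+1)// rect_eventS_integral//.
  rewrite -integral_tupleE; [|by apply: measurable_rect_mix => //; exact: mo|
    by move=> t; exact: rect_mix_ge0].
  rewrite (_ : integral_tuple _ = 0%E) ?ltxx//.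
  apply/integral_tuple_eq0.
  - by apply: measurable_rect_mix => //; exact: mo.
  - by move=> t; exact: rect_mix_ge0.
  apply: filterS (filter_forall _ null) => t null_t.
  have [->|/eqP gt] := eqVneq (seq_density n (nth 0 t)) 0; first by rewrite mulr0 mul0r.
  rewrite [mix_mass _ _ _]big1 ?mulr0// => l al.
  have := w_ge0 _ _ mN' al; rewrite le_eqVlt => /orP[/eqP <-|wl]; first by rewrite mul0r.
  have [zl|zl] := pselect (0 < density_V (h n l) (nth 0 t (pa n l))); last first.
    by rewrite (cond_mass_bad _ (dh _ _ mN' al))// mulr0.
  have := cond_mass_ge0 _ (dh _ _ mN' al) (only n (B n) n) (nth 0 t (pa n l)).
  rewrite le_eqVlt => /orP[/eqP <-|]; first by rewrite mulr0.
  rewrite {1}/only eqxx => cm; have /eqP := null_t l al wl.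
  rewrite mulf_eq0 => /orP[/eqP|/eqP //].
  rewrite rect_indic_eq1; first by move/eqP; rewrite oner_eq0.
  move=> i im; rewrite /only; case: eqP => // ->; exists (nth 0 t (pa n l)).
  by split.
pose B' i := if i == pa n l then B i `&` C l else B i.
have cB' i : rel_closed r (B' i).
  rewrite /B'; case: eqP => // _ x y [Bx Cx] xy.
  by split; [exact: cB xy|exact: cC xy].
have mB' i := r_meas _ (cB' i).
have B'gt0 i : (i < n)%N -> (0 < P [set t | B' i (Y i t)])%E.
  move=> im; rewrite /B'; case: eqP => [i_pa|_]; last exact: Bgt0 (ltnW im).
  (* The two closed sets are nested, so their intersection is one of them, and each has positive
     probability. *)
  rewrite i_pa; have [sub|sub] := rel_closed_chain _ _ _ r_total (cB i) (cC l).
    have -> : B (pa n l) `&` C l = B i by rewrite -i_pa; exact: setIidl.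
    by rewrite -i_pa; exact: Bgt0 (ltnW im).
  have -> : B (pa n l) `&` C l = C l by rewrite -i_pa; exact: setIidr.
  exact: Cl.
have := IH B' mN1 cB' B'gt0.
(* By contraposition: if the event of length [n.+1] is null, so is the rectangle of [B'], on which
   the last transition has positive probability. *)
rewrite !lt0e !measure_ge0 !andbT; apply: contra => /eqP.
rewrite rect_eventS_integral// -integral_tupleE; [|exact: measurable_rect_mix|
  by move=> t; exact: rect_mix_ge0].
move=> /integral_tuple_eq0 ae0; rewrite has_rect_mass_le//; apply/eqP.
apply/integral_tuple_eq0.
- by apply: measurable_rect_density => //; case/andP: mN1.
- by move=> t; apply: rect_density_ge0; case/andP: mN1.
apply: filterS2 (ae0 _ _) (parents_good _ mN') => [t||]; last 2 first.
- exact: measurable_rect_mix.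
- by move=> t; exact: rect_mix_ge0.
move=> zero good.
have [->|/eqP gt] := eqVneq (seq_density n (nth 0 t)) 0; first by rewrite mulr0.
have [->|/eqP it] := eqVneq (rect_indic n B' (nth 0 t)) 0; first by rewrite mul0r.
have [_ B't] := rect_indicE _ _ _ it.
have pl := pa_lt _ _ mN' al; have := B't _ pl; rewrite {1}/B' eqxx => -[_ [x [xz dx mx]]].
(* Monotonicity carries the positive mass from the witness [x] of membership in [C l] to the actual
   parent value. *)
have mz := lt_le_trans mx (h_mono _ _ mN' al _ _ _ (cB n) dx (good gt l al wl) xz).
move: zero; rewrite rect_indic_eq1; last first.
  by move=> i im; have := B't i im; rewrite /B'; case: eqP => // _ [].
rewrite mul1r => /eqP; rewrite mulf_eq0 => /orP[/eqP //|].
rewrite psumr_eq0 => [/allP /(_ l (mem_index_enum l))|k ak]; last first.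
  by rewrite mulr_ge0 ?w_ge0// (cond_mass_ge0 _ (dh _ _ mN' ak)).
by rewrite al/= mulf_eq0 !gt_eqF.
Qed.

End mixture_sequence.

(** * Quantiles *)

Section quantile.
Context {R : realType} {d} {T : measurableType d} {P : probability T R}.
Variables (X : {RV P >-> R}) (q : R).
Hypotheses (q_gt0 : 0 < q) (q_lt1 : q < 1).

Lemma measurable_RV_preimage (A : set R) : measurable A ->
  measurable [set t | A (X t)].
Proof. by move=> mA; rewrite -[Y in measurable Y]setTI; exact: measurable_funP. Qed.

Lemma cdfE x : cdf X x = (dist_fun X x)%:E.
Proof.
rewrite /dist_fun fineK// /cdf /distribution /pushforward fin_num_measure//.
exact: measurable_RV_preimage.
Qed.

Lemma dist_funE x : (dist_fun X x)%:E = P [set t | X t <= x].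
Proof. by rewrite -cdfE /cdf /distribution /pushforward set_itvE. Qed.

Lemma dist_fun_nondecreasing x y : x <= y -> dist_fun X x <= dist_fun X y.
Proof.
move=> xy; rewrite -lee_fin !dist_funE; apply: le_measure; rewrite ?inE.
- by have := measurable_RV_preimage _ (measurable_itv `]-oo, x]); rewrite set_itvE.
- by have := measurable_RV_preimage _ (measurable_itv `]-oo, y]); rewrite set_itvE.
- by move=> t /= /le_trans; apply.
Qed.

(** The distribution function tends to 1, above [q], and to 0, below [q]. *)
Lemma has_inf_quantile : has_inf [set x | q <= dist_fun X x].
Proof.
split.
  apply: contrapT => /set0P/negP; rewrite negbK => /eqP S0.
  suff : (1 <= q%:E)%E by rewrite lee_fin leNgt q_lt1.
  apply: cvge_le (cvg_cdfy1 X); apply: nearW => x.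
  rewrite cdfE lee_fin ltW// ltNge; apply/negP => qx.
  by have : [set x | q <= dist_fun X x] x by []; rewrite S0.
apply: contrapT => nlb; suff : (q%:E <= 0)%E by rewrite lee_fin leNgt q_gt0.
apply: cvge_ge (cvg_cdfNy0 X); apply: nearW => x.
rewrite cdfE lee_fin leNgt; apply/negP => xq; apply: nlb; exists x => y /= qy.
rewrite leNgt; apply/negP => /ltW/dist_fun_nondecreasing yx.
by have := lt_le_trans xq (le_trans qy yx); rewrite ltxx.
Qed.

Lemma quantile_lt x : quantile (dist_fun X) q < x -> q <= dist_fun X x.
Proof.
move=> /(inf_lt has_inf_quantile.1)[y qy yx].
by apply: (le_trans qy); apply: dist_fun_nondecreasing; exact: ltW.
Qed.

Lemma lt_quantile x : x < quantile (dist_fun X) q -> dist_fun X x < q.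
Proof.
move=> xQ; rewrite ltNge; apply/negP => qx; move: xQ; rewrite ltNge.
by move/negP; apply; apply: ge_inf qx; exact: has_inf_quantile.2.
Qed.

(** By right continuity the distribution function is at least [q] at the quantile, even if there is
    an atom. *)
Lemma le_quantile_gt0 : (0 < P [set t | (X t <= quantile (dist_fun X) q)%R])%E.
Proof.
set Q := quantile _ _; apply: (@lt_le_trans _ _ q%:E); first by rewrite lte_fin.
rewrite -dist_funE -cdfE; apply: cvge_ge (@cdf_right_continuous _ _ _ P X Q).
near=> x; rewrite cdfE lee_fin; apply: quantile_lt; near: x; exact: nbhs_right_gt.
Unshelve. all: by end_near. Qed.

(** Strictly below the quantile there is mass at most [q < 1]; without an atom at the quantile, the
    rest must lie above. *)
Lemma gt_quantile_gt0 : P [set t | X t = quantile (dist_fun X) q] = 0%E ->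
  (0 < P [set t | (quantile (dist_fun X) q < X t)%R])%E.
Proof.
set Q := quantile _ _ => Q0.
(* Closed half-lines increasing to the open one; each has mass below [q]. *)
pose F k := [set t | X t <= Q - k.+1%:R^-1].
have mF k : measurable (F k).
  by have := measurable_RV_preimage _ (measurable_itv `]-oo, Q - k.+1%:R^-1]); rewrite set_itvE.
have mlt : measurable [set t | X t < Q].
  by have := measurable_RV_preimage _ (measurable_itv `]-oo, Q[); rewrite set_itvE.
have mgt : measurable [set t | Q < X t].
  by have := measurable_RV_preimage _ (measurable_itv `]Q, +oo[); rewrite set_itvE.
have meq : measurable [set t | X t = Q].
  exact: (measurable_RV_preimage _ (measurable_set1 Q)).
have FE : \bigcup_k F k = [set t | X t < Q].
  apply/seteqP; split => t.
    by move=> [k _ /= /le_lt_trans]; apply; rewrite ltrBlDr ltrDl invr_gt0.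
  move=> /= tQ; have tQ0 : 0 < Q - X t by rewrite subr_gt0.
  have [k kQ] := filter_ex (near_infty_natSinv_lt (PosNum tQ0)).
  by exists k => //=; rewrite /F /= lerBrDr -lerBrDl ltW.
have lt_le_q : (P [set t | (X t < Q)%R] <= q%:E)%E.
  have cvgF : P \o F @ \oo --> P [set t | X t < Q].
    rewrite -FE; apply: nondecreasing_cvg_mu => //; first by rewrite FE.
    move=> i j ij; apply/subsetPset => t /= /le_trans; apply.
    by rewrite lerB// lef_pV2 ?posrE// ler_nat.
  apply: cvge_le cvgF; apply: nearW => k /=; rewrite /F -dist_funE lee_fin ltW// lt_quantile//.
  by rewrite ltrBlDr ltrDl invr_gt0.
rewrite lt0e measure_ge0 andbT; apply/eqP => gt0.
have : P setT = 1%E by exact: probability_setT.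
have -> : [set: T] = [set t | X t < Q] `|` ([set t | X t = Q] `|` [set t | Q < X t]).
  by apply/seteqP; split => // t _ /=; case: (ltgtP (X t) Q); [left|right; right|right; left].
rewrite measureU//; [|exact: measurableU|]; last first.
  apply/seteqP; split => // t /= [tQ [tQ'|/(lt_trans tQ)]]; last by rewrite ltxx.
  by rewrite tQ' ltxx in tQ.
rewrite measureU//; last by apply/seteqP; split => // t /= [->]; rewrite ltxx.
rewrite [X in (_ + (X + _))%E]Q0 [X in (_ + (_ + X))%E]gt0 !adde0 => lt1; move: lt_le_q; rewrite lt1 lee_fin leNgt.
by rewrite q_lt1.
Qed.

End quantile.

(** * The nearest-neighbor process as a mixture sequence *)

Section nnmp_as_sequence.
Context {R : realType} {p n L : nat}.
Variables (D : set 'rV[R]_p) (s : 'I_n -> 'rV[R]_p).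
Variables (nb : 'rV[R]_p -> 'I_L -> 'I_n) (w : 'rV[R]_p -> 'I_L -> R).
Variable h : 'rV[R]_p -> 'I_L -> R -> R -> R.
Hypotheses (L_gt0 : (0 < L)%N) (n_gt0 : (0 < n)%N).
Hypotheses (s_inj : injective s) (s_D : forall i, D (s i)).
Hypothesis nb_ok : is_neighbor_map s nb D.
Hypothesis w_ok : is_weights s w D.
Hypothesis h_density : forall v l, D v -> bivariate_density (h v l).

Context {d} {T : measurableType d} {P : probability T R}.
Variables (Z : 'rV[R]_p -> {RV P >-> R}) (f1 : R -> R).
Hypothesis Z_nnmp : is_nnmp s nb w h Z D f1.

Lemma candidates_ref i j : (j \in candidates s (s i)) = (j < i)%N.
Proof.
rewrite inE; apply/forallP/idP => [/(_ i)|ji k]; first by rewrite eqxx.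
by apply/implyP => /eqP/s_inj ->.
Qed.

Lemma candidates_nonref v j : (forall i, s i <> v) -> j \in candidates s v.
Proof. by move=> sv; rewrite inE; apply/forallP => k; apply/implyP => /eqP/sv. Qed.

Section with_target.
(* [r] is 0 when [v] is a reference location and 1 otherwise. *)
Variables (r : nat) (v : 'rV[R]_p).
Hypotheses (Dv : D v) (r_le1 : (r <= 1)%N).
Hypothesis v_new : (0 < r)%N -> forall i, s i <> v.

(** One sequence for all cases: the reference locations in order, then the target [v] as default
    value, which falls within the [n + r] times only if [r = 1]. *)
Definition loc (i : nat) : 'rV[R]_p := if insub i is Some k then s k else v.

Lemma loc_ref (i : 'I_n) : loc i = s i.
Proof. by rewrite /loc; case: insubP => [k _ /val_inj ->|]; rewrite ?ltn_ord. Qed.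

Lemma loc_new i : (n <= i)%N -> loc i = v.
Proof. by move=> ni; rewrite /loc; case: insubP => // k; rewrite ltnNge ni. Qed.

Lemma loc_D i : D (loc i).
Proof. by rewrite /loc; case: insub. Qed.

Let act i := [pred l : 'I_L | (l < num_neighbors (L := L) s (loc i))%N].
Let pa i l : nat := nb (loc i) l.

Lemma loc_candidate i (j : 'I_n) : (i < n + r)%N ->
  (j \in candidates s (loc i)) = (j < i)%N.
Proof.
move=> iN; have [ni|ltin] := leqP n i.
  rewrite loc_new// candidates_nonref ?(leq_trans (ltn_ord j))//.
  apply: v_new; rewrite lt0n; apply/eqP => r0.
  by move: iN; rewrite r0 addn0 ltnNge ni.
by rewrite -[i]/(val (Ordinal ltin)) loc_ref candidates_ref.
Qed.

Lemma loc_num_neighbors i : (0 < i < n + r)%N -> (0 < num_neighbors (L := L) s (loc i))%N.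
Proof.
move=> /andP[i0 iN]; rewrite /num_neighbors leq_min L_gt0 andbT.
by apply/card_gt0P; exists (Ordinal n_gt0); rewrite loc_candidate.
Qed.

Lemma loc_pa_lt i l : (0 < i < n + r)%N -> act i l -> (pa i l < i)%N.
Proof.
move=> /andP[_ iN] al; rewrite /pa -loc_candidate//.
by have [+ _ _ _] := nb_ok _ (loc_D i); apply.
Qed.

Lemma loc_weights_ge0 i l : (0 < i < n + r)%N -> act i l -> 0 <= w (loc i) l.
Proof.
move=> iN al; have [+ _] := w_ok _ (loc_D i) (loc_num_neighbors _ iN); exact.
Qed.

Lemma loc_weights_sum i : (0 < i < n + r)%N ->
  \sum_(l < L | act i l) w (loc i) l = 1.
Proof. by move=> iN; have [_] := w_ok _ (loc_D i) (loc_num_neighbors _ iN). Qed.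

(** Splitting the product over [n + r] at [n] recovers the reference factors and the possible target
    factor of the process. *)
Lemma loc_joint_density :
  has_joint_density (fun i : 'I_(n + r) => Z (loc i))
    (fun t : (n + r).-tuple R =>
       seq_density f1 (fun i => h (loc i)) act (fun i => w (loc i)) pa (n + r) (nth 0 t)).
Proof.
have [_ _ _ joint] := Z_nnmp.
have inj_v : injective (fun _ : 'I_r => v).
  move=> i j _; apply: ord_inj; move: (ltn_ord i) (ltn_ord j) => ir jr.
  by move: (leq_trans ir r_le1) (leq_trans jr r_le1); rewrite !ltnS !leqn0 => /eqP -> /eqP ->.
have := joint r (fun=> v) inj_v (fun=> Dv) _.
have new i (j : 'I_r) : s i <> v by apply: v_new; exact: leq_ltn_trans (ltn_ord j).
move=> /(_ new).
have -> : (fun k : 'I_(n + r) => match fintype.split k with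
    | inl i => Z (s i) | inr j => Z v end) = (fun i : 'I_(n + r) => Z (loc i)).
  apply/funext => k; case: splitP => [i ki|j kj]; first by rewrite ki loc_ref.
  by rewrite kj loc_new// leq_addr.
congr has_joint_density; apply/funext => t.
have nthl (i : 'I_n) : tnth t (lshift r i) = nth 0 t i by rewrite (tnth_nth 0).
rewrite /nnmp_joint_density /seq_density big_split_ord/=; congr (_ * _).
  apply: eq_bigr => i _; rewrite /mix_density; case: eqP => [_|_]; first by rewrite nthl.
  rewrite nthl /nnmp_cond_density /act /pa/= loc_ref; apply: eq_bigr => l _.
  by rewrite nthl.
apply: eq_bigr => j _; rewrite /mix_density gtn_eqF ?addn_gt0 ?n_gt0//.
rewrite /act /pa/= loc_new ?leq_addr// /nnmp_cond_density; apply: eq_bigr => l _.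
by rewrite nthl (tnth_nth 0).
Qed.

Section tail.
Variable ord : rel R.
Hypothesis r_refl : reflexive ord.
Hypothesis r_trans : transitive ord.
Hypothesis r_total : total ord.
Hypothesis r_meas : forall A, rel_closed ord A -> measurable A.
Hypothesis h_mono : forall v l, D v -> stoch_monotone ord (h v l).

Lemma loc_cond_prob_ge m (A : set R) (B : 'I_n -> set R) (b : 'I_L -> R) :
  (0 < m < n + r)%N -> loc m = v ->
  rel_closed ord A -> (forall j, rel_closed ord (B j)) ->
  (forall j, 0 < P [set t | B j (Z (s j) t)])%E ->
  (forall (l : 'I_L) x, (l < num_neighbors (L := L) s v)%N -> B (nb v l) x -> ord (b l) x) ->
  \sum_(l < L | (l < num_neighbors (L := L) s v)%N) w v l * cond_mass (h v l) A (b l) <=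
  cond_prob P [set t | A (Z v t)]
    [set t | forall l : 'I_L, (l < num_neighbors (L := L) s v)%N ->
      B (nb v l) (Z (s (nb v l)) t)].
Proof.
move=> mN mv cA cB Bgt0 bB; have [f1_meas f1_ge0 f1_int _] := Z_nnmp.
(* Transfers the constraints on the neighbors to times; a time that is no parent of [m] is
   unconstrained. *)
pose B' i : set R := [set x | forall l, act m l -> pa m l = i -> B (nb v l) x].
have cB' i : rel_closed ord (B' i).
  by move=> x y Bx xy l al pal; apply: (cB (nb v l)) xy; exact: Bx.
have mB' i : measurable (B' i) by exact: r_meas.
pose ev := rect_event (fun i => Z (loc i)) m B'.
have -> : [set t | forall l : 'I_L, (l < num_neighbors (L := L) s v)%N ->
      B (nb v l) (Z (s (nb v l)) t)] = ev.
  apply/seteqP; split => t tB.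
    move=> i im l; rewrite /act/= mv => lv <-; rewrite /pa mv loc_ref; exact: tB.
  move=> l lv; have al : act m l by rewrite /act/= mv.
  have := tB (pa m l) (loc_pa_lt _ _ mN al) l al erefl.
  by rewrite /pa mv loc_ref.
have h_dens i l : (0 < i < n + r)%N -> act i l -> bivariate_density (h (loc i) l).
  by move=> _ _; apply: h_density; exact: loc_D.
have h_mon i l : (0 < i < n + r)%N -> act i l -> stoch_monotone ord (h (loc i) l).
  by move=> _ _; apply: h_mono; exact: loc_D.
have mN1 : (0 < m <= n + r)%N by case/andP: mN => -> /ltnW ->.
have ev_gt0 : (0 < P ev)%E.
  apply: (rect_event_gt0 f1 (fun i => h (loc i)) act (fun i => w (loc i)) pa (n + r)
    f1_meas f1_ge0 f1_int h_dens loc_weights_ge0 loc_weights_sum loc_pa_lt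
    (fun i => Z (loc i)) loc_joint_density ord) => // i im.
   have [[l [al pal]]|none] := pselect (exists l, act m l /\ pa m l = i).
      have nbi : nb v l = i :> nat by rewrite -mv.
      have -> : [set t | B' i (Z (loc i) t)] = [set t | B (nb v l) (Z (s (nb v l)) t)].
        apply/seteqP; split => t /=.
          by move=> /(_ l al pal); rewrite -nbi loc_ref.
        rewrite -nbi loc_ref => Bt l' _; rewrite /pa mv => /val_inj nbE.
        by rewrite nbE.
      exact: Bgt0.
    have -> : [set t | B' i (Z (loc i) t)] = setT.
      by apply/seteqP; split => // t _ l al pal; exfalso; apply: none; exists l.
    by rewrite probability_setT.
have le_ev : ((\sum_(l < L | (l < num_neighbors (L := L) s v)%N)
      w v l * cond_mass (h v l) A (b l))%:E * P ev <=
    P (ev `&` [set t | A (Z v t)]))%E.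
  have := rect_event_ge f1 (fun i => h (loc i)) act (fun i => w (loc i)) pa (n + r)
    f1_meas f1_ge0 f1_int h_dens loc_weights_ge0 loc_weights_sum loc_pa_lt
    (fun i => Z (loc i)) loc_joint_density ord r_meas h_mon m B' A b mN mB' cA.
  rewrite -/ev /act/= mv; apply => l x lv.
  have al : act m l by rewrite /act/= mv.
  by move=> /(_ l al erefl); exact: bB.
have mev : measurable ev by exact: measurable_rect_event.
have mA : measurable [set t | A (Z v t)].
  exact: (measurable_RV_preimage (Z v) _ (r_meas _ cA)).
rewrite /cond_prob ler_pdivlMr; last first.
  by rewrite fine_gt0// ev_gt0/= (le_lt_trans (probability_le1 _ mev))// ltry.
have fin_ev : P ev \is a fin_num by exact: fin_num_measure.
have fin_I : P (ev `&` [set t | A (Z v t)]) \is a fin_num.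
  by apply: fin_num_measure; exact: measurableI.
by rewrite -lee_fin EFinM setIC !fineK.
Qed.

End tail.
End with_target.

(** With [r = 0] the sequence is the reference set alone, whose law has a density. *)
Lemma ref_null j b : P [set t | Z (s j) t = b] = 0%E.
Proof.
have := coordinate_null _ _ _ _ _ _ (fun i => Z (loc (s j) i))
  (@loc_joint_density 0 (s j) (s_D j) isT (fun r0 => False_ind _ (notF r0))) j b.
by rewrite loc_ref addn0; exact.
Qed.

Section direction.
Variable r : rel R.
Hypothesis r_refl : reflexive r.
Hypothesis r_trans : transitive r.
Hypothesis r_total : total r.
Hypothesis r_meas : forall A, rel_closed r A -> measurable A.
Hypothesis h_mono : forall v l, D v -> stoch_monotone r (h v l).

(** A location outside the reference set is time [n] of the extended sequence; a reference location
    [s i] with [i > 0] is time [i] of the reference sequence. *)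
Lemma nnmp_cond_prob_ge v (A : set R) (B : 'I_n -> set R) (b : 'I_L -> R) :
  D v -> rel_closed r A -> (forall j, rel_closed r (B j)) ->
  (forall j, 0 < P [set t | B j (Z (s j) t)])%E ->
  (forall (l : 'I_L) x, (l < num_neighbors (L := L) s v)%N -> B (nb v l) x -> r (b l) x) ->
  \sum_(l < L | (l < num_neighbors (L := L) s v)%N) w v l * cond_mass (h v l) A (b l) <=
  cond_prob P [set t | A (Z v t)]
    [set t | forall l : 'I_L, (l < num_neighbors (L := L) s v)%N ->
      B (nb v l) (Z (s (nb v l)) t)].
Proof.
move=> Dv cA cB Bgt0 bB.
have [[i siv]|v_new] := pselect (exists i, s i = v); last first.
  have new i : s i <> v by move=> siv; apply: v_new; exists i.
  apply: (@loc_cond_prob_ge 1 v Dv isT (fun=> new) r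
    r_refl r_trans r_total r_meas h_mono n) => //.
  - by rewrite n_gt0 addn1 ltnSn.
  - exact: loc_new.
have [i0|i_gt0] := posnP i; last first.
  apply: (@loc_cond_prob_ge 0 v Dv isT (fun r0 => False_ind _ (notF r0)) r
    r_refl r_trans r_total r_meas h_mono i) => //.
  - by rewrite i_gt0 addn0 ltn_ord.
  - by rewrite loc_ref.
(* The first reference location has no neighbor: the sum is empty and the right-hand side is
   nonnegative. *)
rewrite big1 ?divr_ge0 ?fine_ge0 ?measure_ge0// => l.
suff -> : num_neighbors (L := L) s v = 0%N by [].
rewrite /num_neighbors (_ : #|_| = 0%N) ?min0n//.
by apply: eq_card0 => j; rewrite -siv candidates_ref i0.
Qed.

End direction.
End nnmp_as_sequence.

(** * Tail dependence *)

Lemma sum_lim_le (R : realType) (F : set_system R) (FF : ProperFilter F)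
    (I : finType) (Q : pred I) (c : I -> R) (f : I -> R -> R) (g : R -> R) :
  cvg (g x @[x --> F]) -> (forall i, Q i -> cvg (f i x @[x --> F])) ->
  (\forall x \near F, \sum_(i | Q i) c i * f i x <= g x) ->
  \sum_(i | Q i) c i * lim (f i x @[x --> F]) <= lim (g x @[x --> F]).
Proof.
move=> cg cf le; apply: ler_cvg_to cg le.
apply: cvg_big => [|i Qi]; first exact: add_continuous.
by apply: cvgMl_tmp; exact: cf.
Qed.

(** Each bound presupposes the convergence of the functions involved, because [lim] is a default
    value otherwise. The sums run over the actual neighbors, fewer than [L] at early reference
    locations. *)
Theorem proposition3 (R : realType) (p n L : nat)
  (p_gt0 : (0 < p)%N) (L_gt0 : (0 < L)%N) (L_lt_n : (L < n)%N)
  (D : set 'rV[R]_p)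
  (s : 'I_n -> 'rV[R]_p) (s_inj : injective s) (s_D : forall i, D (s i))
  (nb : 'rV[R]_p -> 'I_L -> 'I_n) (nb_ok : is_neighbor_map s nb D)
  (w : 'rV[R]_p -> 'I_L -> R) (w_ok : is_weights s w D)
  (* parametric families of bivariate densities: [alpha l] is kept fixed, while
     the base value [beta0 l] is extended to the spatially varying [beta v l] *)
  (Alpha Beta : 'I_L -> Type)
  (family : forall l, Alpha l -> Beta l -> R -> R -> R)
  (alpha : forall l, Alpha l) (beta0 : forall l, Beta l)
  (beta : 'rV[R]_p -> forall l, Beta l)
  (base_density : forall l, bivariate_density (family l (alpha l) (beta0 l)))
  (ext_density : forall v l, D v ->
     bivariate_density (family l (alpha l) (beta v l)))
  (base_si : forall l, stoch_increasing (family l (alpha l) (beta0 l)))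
  (carry_over : forall l, stoch_increasing (family l (alpha l) (beta0 l)) ->
     forall v, D v -> stoch_increasing (family l (alpha l) (beta v l)))
  (d : measure_display) (T : measurableType d) (P : probability T R)
  (Z : 'rV[R]_p -> {RV P >-> R}) (f1 : R -> R)
  (Z_nnmp : is_nnmp s nb w (fun v l => family l (alpha l) (beta v l)) Z D f1) :
  forall v, D v ->
  margins_agree s nb (fun v l => family l (alpha l) (beta v l)) Z v ->
  (cvg (upper_tail_prob s nb Z v q @[q --> 1^'-]) ->
   (forall l : 'I_L, (l < num_neighbors (L := L) s v)%N ->
      cvg (component_gt (family l (alpha l) (beta v l)) q @[q --> 1^'-])) ->
   \sum_(l < L | (l < num_neighbors (L := L) s v)%N)
      w v l * lim (component_gt (family l (alpha l) (beta v l)) q @[q --> 1^'-])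
   <= lambda_H s nb Z v) /\
  (cvg (lower_tail_prob s nb Z v q @[q --> 0^'+]) ->
   (forall l : 'I_L, (l < num_neighbors (L := L) s v)%N ->
      cvg (component_le (family l (alpha l) (beta v l)) q @[q --> 0^'+])) ->
   \sum_(l < L | (l < num_neighbors (L := L) s v)%N)
      w v l * lim (component_le (family l (alpha l) (beta v l)) q @[q --> 0^'+])
   <= lambda_L s nb Z v).
Proof.
move=> v Dv agree; pose h v l := family l (alpha l) (beta v l).
have n_gt0 : (0 < n)%N by exact: leq_ltn_trans L_lt_n.
have h_density v' l : D v' -> bivariate_density (h v' l) by exact: ext_density.
have h_si v' l : D v' -> stoch_increasing (h v' l).
  by move=> Dv'; exact: carry_over.
pose Q x := quantile (dist_fun (Z x)).
have Z_null j b : P [set t | Z (s j) t = b] = 0%E.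
  exact: (ref_null D s nb w h n_gt0 s_D Z f1 Z_nnmp).
split=> cvg_tail cvg_comp; apply: sum_lim_le => //.
- near=> q.
  have q_gt0 : 0 < q by near: q; exact: nbhs_left_gt.
  have q_lt1 : q < 1 by near: q; exact: nbhs_left_lt.
  have h_mono v' l : D v' -> stoch_monotone <=%R (h v' l).
    by move=> Dv'; apply: stoch_increasing_le; [exact: h_density|exact: h_si].
  have closed_gt b : rel_closed <=%R [set x : R | b < x].
    by move=> x y /= bx xy; exact: lt_le_trans xy.
  (* Strict upper tails have positive probability because the reference variables have no atoms. *)
  have tail_gt0 j : (0 < P [set t | (Q (s j) q < Z (s j) t)%R])%E.
    by apply: gt_quantile_gt0 => //; exact: Z_null.
  have := nnmp_cond_prob_ge D s nb w h L_gt0 n_gt0 s_inj s_D nb_ok w_ok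
    h_density Z f1 Z_nnmp <=%R (@lexx _ R) (@le_trans _ R) (@le_total _ R)
    rel_closed_le_measurable h_mono v [set x | Q v q < x]
    (fun j => [set x | Q (s j) q < x]) (fun l => Q (s (nb v l)) q) Dv
    (closed_gt _) (fun j => closed_gt _) tail_gt0 (fun l x _ => @ltW _ R _ x).
  (* [margins_agree] turns the quantiles of the process into those of the component, and [cond_gt]
     is [cond_mass] of an open half-line. *)
  apply: le_trans; apply: ler_sum => l lv; have [eqU eqV] := agree l lv.
  by rewrite /component_gt -eqU -eqV /cond_gt set_itvE.
- near=> q.
  have q_gt0 : 0 < q by near: q; exact: nbhs_right_gt.
  have q_lt1 : q < 1 by near: q; exact: nbhs_right_lt.
  (* Same argument for the reverse order, in which the tails [x <= Q] are the closed sets. *)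
  have h_mono v' l : D v' -> stoch_monotone >=%R (h v' l).
    by move=> Dv'; apply: stoch_increasing_ge; [exact: h_density|exact: h_si].
  have closed_le b : rel_closed >=%R [set x : R | x <= b].
    by move=> x y /= xb yx; exact: le_trans yx xb.
  have tail_gt0 j : (0 < P [set t | (Z (s j) t <= Q (s j) q)%R])%E.
    exact: le_quantile_gt0.
  have := nnmp_cond_prob_ge D s nb w h L_gt0 n_gt0 s_inj s_D nb_ok w_ok
    h_density Z f1 Z_nnmp >=%R (@lexx _ R) (@ge_trans _ R)
    (fun x y => le_total y x)
    rel_closed_ge_measurable h_mono v [set x | x <= Q v q]
    (fun j => [set x | x <= Q (s j) q]) (fun l => Q (s (nb v l)) q) Dv
    (closed_le _) (fun j => closed_le _) tail_gt0 (fun l x _ xQ => xQ).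
  apply: le_trans; apply: ler_sum => l lv; have [eqU eqV] := agree l lv.
  by rewrite /component_le -eqU -eqV /cond_le set_itvE.
Unshelve. all: by end_near. Qed.
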